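(* Let $0<c\le d$ and let $L$ be the isosceles trapezoidal polygon (boundary of the trapezoid) of height $1$ with vertices $-d-i$, $-c$, $c$, $d-i$. Then $$QR_L\le\left(\sqrt{1+\tau^2}+\tau\right)^2,\qquad \tau=\max\left\{c+d,\ \frac{1-c^2+d^2}{2c}\right\}.$$
   Context: For a quasicircle $L\subset\mathbb{C}$, a quasiconformal reflection with respect to $L$ is a sense-reversing quasiconformal automorphism of the Riemann sphere which keeps every point of $L$ fixed and interchanges the bounded and unbounded complementary components of $L$. $QR_L$ denotes the minimal coefficient (maximal dilatation) $K\ge1$ such that there is a $K$-quasiconformal reflection with respect to $L$. *)

(* Defs.v *)
From HB Require Import structures.
From mathcomp Require Import all_boot all_order all_algebra.
From mathcomp Require Import all_classical all_reals all_analysis.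
Import Order.TTheory GRing.Theory Num.Theory.
Import numFieldNormedType.Exports.

Set Implicit Arguments.
Unset Strict Implicit.
Unset Printing Implicit Defensive.

Local Open Scope classical_set_scope.
Local Open Scope ring_scope.

(* The complex plane is R * R, with z = (x, y) standing for x + i y: this gives
   the library's product topology and product Lebesgue measure.  The library
   norm `|z| on R * R is the max norm, hence the Euclidean modulus cmod. *)
Section Plane.
Variable R : realType.
Implicit Types z : R * R.

Definition cmod z : R := Num.sqrt (z.1 ^+ 2 + z.2 ^+ 2).

Definition cconj z : R * R := (z.1, - z.2).

(* 1 / z, with value 0 at z = 0 *)
Definition cinv z : R * R :=
  (z.1 / (z.1 ^+ 2 + z.2 ^+ 2), - z.2 / (z.1 ^+ 2 + z.2 ^+ 2)).

End Plane.

Section AnalyticQuasiconformality.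
Variable R : realType.
Implicit Types (f : R * R -> R * R) (U : set (R * R)) (z : R * R).

(* The non-overlapping subintervals [p.1, p.2] of [a, b] are listed from left
   to right. *)
Definition absolutely_continuous_on (a b : R) (g : R -> R) : Prop :=
  forall e : R, 0 < e -> exists2 delta : R, 0 < delta &
    forall s : seq (R * R),
      all (fun p => [&& a <= p.1, p.1 <= p.2 & p.2 <= b]) s ->
      pairwise (fun p q => p.2 <= q.1) s ->
      \sum_(p <- s) (p.2 - p.1) < delta ->
      \sum_(p <- s) `|g p.2 - g p.1| < e.

Definition ACL U f : Prop :=
  forall a b c d : R, a < b -> c < d -> `[a, b] `*` `[c, d] `<=` U ->
    {ae (@lebesgue_measure R), forall y, y \in `[c, d] ->
       absolutely_continuous_on a b (fun x => (f (x, y)).1) /\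
       absolutely_continuous_on a b (fun x => (f (x, y)).2)} /\
    {ae (@lebesgue_measure R), forall x, x \in `[a, b] ->
       absolutely_continuous_on c d (fun y => (f (x, y)).1) /\
       absolutely_continuous_on c d (fun y => (f (x, y)).2)}.

Definition has_partials f z : Prop :=
  [/\ derivable (fun x : R => (f (x, z.2)).1) z.1 1,
      derivable (fun x : R => (f (x, z.2)).2) z.1 1,
      derivable (fun y : R => (f (z.1, y)).1) z.2 1 &
      derivable (fun y : R => (f (z.1, y)).2) z.2 1].

Definition partial_x f z : R * R :=
  (derive1 (fun x : R => (f (x, z.2)).1) z.1,
   derive1 (fun x : R => (f (x, z.2)).2) z.1).

Definition partial_y f z : R * R :=
  (derive1 (fun y : R => (f (z.1, y)).1) z.2,
   derive1 (fun y : R => (f (z.1, y)).2) z.2).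

(* Wirtinger derivatives (f_x - i f_y) / 2 and (f_x + i f_y) / 2 *)
Definition d_z f z : R * R :=
  (((partial_x f z).1 + (partial_y f z).2) / 2,
   ((partial_x f z).2 - (partial_y f z).1) / 2).

Definition d_zbar f z : R * R :=
  (((partial_x f z).1 - (partial_y f z).2) / 2,
   ((partial_x f z).2 + (partial_y f z).1) / 2).

(* Analytic definition of (sense-preserving) K-quasiconformality; it is meant
   for f a homeomorphism of the open set U onto its image.  ACL already implies
   that the partial derivatives exist almost everywhere; this is repeated
   because derivatives are total functions in the library. *)
Definition analytic_qc (K : R) U f : Prop :=
  ACL U f /\
  {ae (@lebesgue_measure R \x @lebesgue_measure R)%E, forall z, U z ->
     has_partials f z /\
     cmod (d_zbar f z) <= (K - 1) / (K + 1) * cmod (d_z f z)}.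

End AnalyticQuasiconformality.

(* The Riemann sphere, None being the point at infinity *)
Notation sphere R := (one_point_compactification (R * R)%type).

Section Sphere.
Variable R : realType.
Implicit Types f g : sphere R -> sphere R.

(* z |-> 1 / z as an automorphism of the sphere *)
Definition sphere_inv (p : sphere R) : sphere R :=
  if p is Some z then (if z == (0, 0) then None else Some (cinv z))
  else Some (0, 0).

Definition sphere_conj (p : sphere R) : sphere R :=
  if p is Some z then Some (cconj z) else None.

Definition homeomorphism f : Prop :=
  continuous f /\
  exists g, [/\ continuous g, cancel f g & cancel g f].

Definition finite_dom f : set (R * R) := [set z | f (Some z) <> None].

Definition finite_part f (z : R * R) : R * R :=
  if f (Some z) is Some w then w else (0, 0).

(* The sphere is covered by the two holomorphic charts z and 1 / z; the four
   conditions are K-quasiconformality in these charts at source and target. *)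
Definition quasiconformal (K : R) f : Prop :=
  let qc g := analytic_qc K (finite_dom g) (finite_part g) in
  homeomorphism f /\
  [/\ qc f, qc (f \o sphere_inv), qc (sphere_inv \o f) &
      qc (sphere_inv \o f \o sphere_inv)].

Definition sense_reversing_quasiconformal (K : R) f : Prop :=
  quasiconformal K (sphere_conj \o f).

Definition inner_domain (L : set (R * R)) : set (sphere R) :=
  [set Some z | z in [set z | ~ L z /\
     bounded_set (connected_component (~` L) z)]].

(* the unbounded components of the complement, together with infinity *)
Definition outer_domain (L : set (R * R)) : set (sphere R) :=
  None |` [set Some z | z in [set z | ~ L z /\
     ~ bounded_set (connected_component (~` L) z)]].

Definition quasiconformal_reflection (K : R) (L : set (R * R)) f : Prop :=
  [/\ sense_reversing_quasiconformal K f,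
      (forall z, L z -> f (Some z) = Some z),
      f @` inner_domain L = outer_domain L &
      f @` outer_domain L = inner_domain L].

(* The infimum is taken in the extended reals, so that QR L = +oo, rather than
   a junk real value, if L admits no quasiconformal reflection. *)
Definition QR (L : set (R * R)) : \bar R :=
  ereal_inf [set K%:E | K in [set K : R | 1 <= K /\
     exists f, quasiconformal_reflection K L f]].

End Sphere.

Section Trapezoid.
Variable R : realType.

Definition segment (a b : R * R) : set (R * R) :=
  [set ((1 - t) * a.1 + t * b.1, (1 - t) * a.2 + t * b.2) | t in `[0, 1]].

Definition trapezoid (c d : R) : set (R * R) :=
  segment (- d, - 1) (- c, 0) `|` segment (- c, 0) (c, 0) `|`
  segment (c, 0) (d, - 1) `|` segment (d, - 1) (- d, - 1).

End Trapezoid.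

(* Main.v *)
(* Seen from a centre z0, a star-shaped curve has a polar equation r = rho(theta),
   and r e^(i theta) |-> (rho(theta)^2 / r) e^(i theta) is a reflection in it.  In
   the coordinates (log r, theta) it is a reflection composed with the shear of
   slope 2 rho'/rho, so its dilatation is (sqrt (1 + t^2) + t)^2, where t bounds
   the cotangent |rho'/rho| of the angle between radius and curve.  For a convex
   polygon, rho is the inverse of a gauge, the maximum of one linear functional
   per side: the reflection is v |-> v / gauge(v)^2, which is rational on each
   sector, and the sector boundaries are null sets in every chart. *)
Require Import Defs.
From mathcomp Require Import all_boot all_order all_algebra.
From mathcomp Require Import all_classical all_reals all_analysis.
From mathcomp Require Import measurable_realfun ring lra.
Import Order.TTheory GRing.Theory Num.Theory.
Import numFieldNormedType.Exports.

Set Implicit Arguments.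
Unset Strict Implicit.
Unset Printing Implicit Defensive.

Local Open Scope classical_set_scope.
Local Open Scope ring_scope.

(** Absolute continuity on lines does not survive a change of chart, because inversion bends the
    lines. What is carried through the charts is a stronger property: Lipschitz curves go to
    Lipschitz curves. It is lost only at finitely many points, and almost every line avoids these.
    It travels with a bound [|Q| <= k |P|] between the Wirtinger coefficients, which conformal
    factors preserve; here [k = (K - 1) / (K + 1) = tau / sqrt (1 + tau^2)]. Null sets are moved
    between charts by equations rather than by a change of variables: inversion turns the lines
    bounding the sectors into lines or circles. The centre of the trapezoid is the intersection of
    its diagonals. The triangles on the two parallel sides are then similar, and both have the
    extreme cotangent [c + d]. On a slanted side the cotangent is extreme at the corners; the lower
    one dominates and gives [(1 - c^2 + d^2) / (2 c)]. Hence the maximum in [tau]. *)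

Section Lipschitz.
Variable R : realType.
Implicit Types (a b : R) (u v : R -> R).

(** * Lipschitz functions on a closed interval *)

Definition lip_itv a b u : Prop :=
  exists2 K : R, 0 <= K & forall x y, a <= x <= b -> a <= y <= b ->
    `|u x - u y| <= K * `|x - y|.

Lemma lip_itv_cst a b (k : R) : lip_itv a b (fun=> k).
Proof. by exists 0 => // x y _ _; rewrite subrr normr0 mul0r. Qed.

Lemma lip_itv_id a b : lip_itv a b id.
Proof. by exists 1 => // x y _ _; rewrite mul1r. Qed.

Lemma eq_lip_itv a b u v : (forall x, a <= x <= b -> u x = v x) ->
  lip_itv a b u -> lip_itv a b v.
Proof. by move=> uv [K K0 uK]; exists K => // x y xab yab; rewrite -!uv ?uK. Qed.

Lemma lip_itvD a b u v :
  lip_itv a b u -> lip_itv a b v -> lip_itv a b (fun x => u x + v x).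
Proof.
move=> [K K0 uK] [M M0 vM]; exists (K + M); first exact: addr_ge0.
move=> x y xab yab; rewrite opprD addrACA mulrDl.
by rewrite (le_trans (ler_normD _ _))// lerD ?uK ?vM.
Qed.

Lemma lip_itvN a b u : lip_itv a b u -> lip_itv a b (fun x => - u x).
Proof.
move=> [K K0 uK]; exists K => // x y xab yab.
by rewrite -opprD normrN uK.
Qed.

Lemma lip_itv_norm a b u : lip_itv a b u -> lip_itv a b (fun x => `|u x|).
Proof.
move=> [K K0 uK]; exists K => // x y xab yab.
by rewrite (le_trans (ler_dist_dist _ _))// uK.
Qed.

Lemma lip_itv_bounded a b u : lip_itv a b u ->
  exists2 M, 0 <= M & forall x, a <= x <= b -> `|u x| <= M.
Proof.
move=> [K K0 uK]; exists (`|u a| + K * `|b - a|).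
  by rewrite addr_ge0// mulr_ge0.
move=> x xab; have /andP[ax xb] := xab.
rewrite -(subrK (u a) (u x)) (le_trans (ler_normD _ _))// addrC lerD2l.
have aab : a <= a <= b by rewrite lexx (le_trans ax).
rewrite (le_trans (uK _ _ xab aab))// ler_wpM2l//.
by rewrite !ger0_norm ?subr_ge0 ?lerD2r//; exact: le_trans xb.
Qed.

Lemma lip_itvM a b u v :
  lip_itv a b u -> lip_itv a b v -> lip_itv a b (fun x => u x * v x).
Proof.
move=> lu lv; have [A A0 uA] := lip_itv_bounded lu.
have [B B0 vB] := lip_itv_bounded lv.
case: lu lv => [K K0 uK] [M M0 vM].
exists (A * M + K * B); first by rewrite addr_ge0 ?mulr_ge0.
move=> x y xab yab.
have -> : u x * v x - u y * v y = u x * (v x - v y) + (u x - u y) * v y by ring.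
have -> : (A * M + K * B) * `|x - y| = A * (M * `|x - y|) + K * `|x - y| * B by ring.
rewrite (le_trans (ler_normD _ _))// !normrM.
by rewrite lerD// ler_pM ?uA ?vB ?uK ?vM.
Qed.

Lemma lip_itv_continuous a b u : lip_itv a b u -> {within `[a, b], continuous u}.
Proof.
move=> [K K0 uK]; apply/subspace_continuousP => x /=; rewrite in_itv/= => xab.
apply/cvgrPdist_lt => e e0; rewrite near_withinE.
have d0 : 0 < e / (K + 1) by rewrite divr_gt0// ltr_wpDl.
near=> y; rewrite /= in_itv/= => yab.
rewrite (le_lt_trans (uK _ _ xab yab))//.
rewrite (@le_lt_trans _ _ ((K + 1) * `|x - y|))//.
  by rewrite ler_wpM2r// lerDl.
by rewrite mulrC -ltr_pdivlMr ?ltr_wpDl//.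
Unshelve. all: by end_near. Qed.

(** By compactness [|u|] has a positive minimum, which bounds the denominator in
    [1/u x - 1/u y = (u y - u x) / (u x u y)] from below. *)
Lemma lip_itvV a b u : a <= b -> (forall x, a <= x <= b -> u x != 0) ->
  lip_itv a b u -> lip_itv a b (fun x => (u x)^-1).
Proof.
move=> ab u0 lu.
have cu := lip_itv_continuous (lip_itv_norm lu).
have [c cab uc] := EVT_min ab cu.
have uc0 : 0 < `|u c| by rewrite normr_gt0 u0//; move: cab; rewrite in_itv.
have um x : a <= x <= b -> `|u c| <= `|u x| by move=> xab; apply: uc; rewrite in_itv.
case: lu => K K0 uK; exists (K / (`|u c| * `|u c|)).
  by rewrite divr_ge0// mulr_ge0.
move=> x y xab yab.
have -> : (u x)^-1 - (u y)^-1 = (u y - u x) / (u x * u y).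
  by field; rewrite !u0.
rewrite normrM distrC mulrAC ler_pM// ?uK// normfV normrM.
by rewrite lef_pV2 ?posrE ?mulr_gt0// ?normr_gt0 ?u0// ler_pM ?um.
Qed.

Lemma lip_itv_max a b u v :
  lip_itv a b u -> lip_itv a b v -> lip_itv a b (fun x => Num.max (u x) (v x)).
Proof.
move=> lu lv; apply: (@eq_lip_itv _ _ (fun x => v x +
    (u x - v x + `|u x - v x|) * 2^-1)).
  move=> x _; case: (leP (u x) (v x)) => h.
    by rewrite ler0_norm ?subr_le0//; field.
  by rewrite gtr0_norm ?subr_gt0//; field.
have luv : lip_itv a b (fun x => u x - v x) by apply/lip_itvD/lip_itvN.
apply: lip_itvD => //; apply: lip_itvM; last exact: lip_itv_cst.
by apply: lip_itvD => //; exact: lip_itv_norm.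
Qed.

Lemma lip_itv_bigmax (I : Type) (s : seq I) a b (u : I -> R -> R) :
  (forall i, lip_itv a b (u i)) ->
  lip_itv a b (fun x => \big[Num.max/0]_(i <- s) u i x).
Proof.
move=> lu; elim: s => [|i s ih].
  by apply: (@eq_lip_itv _ _ (fun=> 0)); [move=> x _; rewrite big_nil|exact: lip_itv_cst].
apply: (@eq_lip_itv _ _ _ _ _ (lip_itv_max (lu i) ih)) => x _.
by rewrite big_cons.
Qed.

Lemma lip_itv_absolutely_continuous a b u :
  lip_itv a b u -> absolutely_continuous_on a b u.
Proof.
(* The denominator is [K + 1] because [K] may be 0. *)
move=> [K K0 uK] e e0; exists (e / (K + 1)); first by rewrite divr_gt0// ltr_wpDl.
move=> s sab _; rewrite ltr_pdivlMr ?ltr_wpDl// mulrC; apply: le_lt_trans.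
rewrite mulr_sumr big_seq [leRHS]big_seq; apply: ler_sum => p ps.
have /and3P[ap pp pb] := allP sab p ps.
have p1ab : a <= p.1 <= b by rewrite ap (le_trans pp).
have p2ab : a <= p.2 <= b by rewrite pb (le_trans ap).
rewrite (le_trans (uK _ _ p2ab p1ab))// ger0_norm ?subr_ge0//.
by rewrite ler_wpM2r ?subr_ge0// lerDl.
Qed.

End Lipschitz.

(** * Lines and circles are null sets *)

Section NullSets.
Variable R : realType.
Local Notation mu := (@lebesgue_measure R).

(** The product measure integrates the measures of the vertical sections. The exceptional set [S]
    leaves room for vertical lines. *)
Lemma negligible_of_sections (N : set (R * R)) (S : set R) :
  measurable N -> countable S -> (forall x, ~ S x -> countable (xsection N x)) ->
  (mu \x mu)%E.-negligible N.
Proof.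
move=> mN cS NS.
apply/(@negligibleP _ _ _ (mu \x mu)%E) => //.
have mS : measurable S by exact: countable_measurable.
transitivity (\int[mu]_(x in setT `\` S) mu (xsection N x))%E.
  apply: (@ge0_negligible_integral _ _ _ mu setT S) => //.
  - exact: measurable_fun_xsection.
  - exact: countable_lebesgue_measure0.
rewrite setTD; apply: integral0_eq => x Sx.
exact/countable_lebesgue_measure0/NS.
Qed.

Lemma quadratic_roots_countable (A B C : R) :
  ~ [/\ A = 0, B = 0 & C = 0] -> countable [set y | A * y ^+ 2 + B * y + C = 0].
Proof.
move=> ABC; apply: finite_set_countable.
have [A0|A0] := eqVneq A 0.
  have [B0|B0] := eqVneq B 0.
    rewrite (_ : [set y | _] = set0)//; apply/seteqP; split => // y /=.
    by rewrite A0 B0 !mul0r !add0r => C0; apply: ABC.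
  apply: (@sub_finite_set _ _ [set - C / B]) => // y /=.
  by rewrite A0 mul0r add0r => /eqP; rewrite addr_eq0 => /eqP <-; field.
have [[y0 /= y0r]|noroot] := pselect ([set y | A * y ^+ 2 + B * y + C = 0] !=set0).
  apply: (@sub_finite_set _ _ [set y0; - B / A - y0]) => // y /= yr.
  have : (y - y0) * (A * (y + y0) + B) = 0.
    by rewrite -[RHS](subrr 0) -{1}yr -y0r; ring.
  move/eqP; rewrite mulf_eq0 subr_eq0 => /orP[/eqP|/eqP h]; first by left.
  have -> : y = - (A * y0 + B) / A.
    by apply: (mulfI A0); rewrite [RHS]mulrC divfK// -[LHS]subr0 -h; ring.
  by right; field.
rewrite (_ : [set y | _] = set0)//; apply/seteqP; split => // y yr.
by apply: noroot; exists y.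
Qed.

(** One family of equations covers lines, circles and single points, and it is stable under
    inversion. For fixed abscissa the equation is quadratic in the ordinate. *)
Lemma circle_negligible (A B C D : R) : ~ [/\ A = 0, B = 0, C = 0 & D = 0] ->
  (mu \x mu)%E.-negligible
    [set z | A * (z.1 ^+ 2 + z.2 ^+ 2) + B * z.1 + C * z.2 + D = 0].
Proof.
move=> ABCD.
(* The abscissas where the quadratic vanishes identically; there are none unless the set is a
   vertical line. The null term gives the shape expected by [quadratic_roots_countable]. *)
pose S := [set x | A = 0 /\ C = 0 /\ 0 * x ^+ 2 + B * x + D = 0].
apply: (@negligible_of_sections _ S).
- pose f (z : R * R) := A * (z.1 * z.1 + z.2 * z.2) + B * z.1 + C * z.2 + D.
  have mf : measurable_fun setT f.
    have m1 : measurable_fun setT (fun z : R * R => z.1) by exact: measurable_fst.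
    have m2 : measurable_fun setT (fun z : R * R => z.2) by exact: measurable_snd.
    apply: measurable_funD => //; apply: measurable_funD; last exact: measurable_funM.
    apply: measurable_funD; last exact: measurable_funM.
    by apply: measurable_funM => //; apply: measurable_funD; exact: measurable_funM.
  rewrite (_ : [set z | _] = setT `&` f @^-1` [set 0]); first exact: mf.
  by rewrite setTI /f /=; apply/seteqP; split => z /=; rewrite !expr2.
- have [[A0 C0]|AC] := pselect (A = 0 /\ C = 0).
    apply: sub_countable (@quadratic_roots_countable 0 B D _).
      by apply: subset_card_le => x [_ []].
    by move=> [_ B0 D0]; apply: ABCD.
  by rewrite (_ : S = set0)//; apply/seteqP; split => // x [A0 [C0 _]]; apply: AC.
- move=> x Sx.
  rewrite (_ : xsection _ x =
    [set y | A * y ^+ 2 + C * y + (A * x ^+ 2 + B * x + D) = 0]).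
    apply: quadratic_roots_countable => -[A0 C0 E]; apply: Sx.
    by split=> //; split => //; move: E; rewrite A0.
  apply/seteqP; split => y; rewrite /xsection/= inE/= => <-.
    by ring.
  by ring.
Qed.
End NullSets.

(** * Wirtinger derivatives along curves *)

Section Wirtinger.
Variable R : realType.
Implicit Types (z P Q : R * R) (F G : R * R -> R * R).

Definition cmul z w : R * R := (z.1 * w.1 - z.2 * w.2, z.1 * w.2 + z.2 * w.1).

Lemma cmod_ge0 z : 0 <= cmod z. Proof. exact: sqrtr_ge0. Qed.

Lemma cmodM z w : cmod (cmul z w) = cmod z * cmod w.
Proof.
rewrite /cmod -sqrtrM ?addr_ge0 ?sqr_ge0//; congr Num.sqrt.
by rewrite /cmul/=; ring.
Qed.

Lemma cmod_conj z : cmod (cconj z) = cmod z.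
Proof. by rewrite /cmod /= sqrrN. Qed.

Lemma is_deriveV_fun (f : R -> R) (t df : R) : is_derive t 1 f df -> f t != 0 ->
  is_derive t 1 (fun s => (f s)^-1) (- df / f t ^+ 2).
Proof.
by move=> hf f0; apply: is_derive_eq (is_deriveV f0 hf) _;
  rewrite /GRing.scale/= -exprVn; ring.
Qed.

Lemma is_deriveM_fun (f g : R -> R) (t df dg : R) :
  is_derive t 1 f df -> is_derive t 1 g dg ->
  is_derive t 1 (fun s => f s * g s) (df * g t + f t * dg).
Proof.
move=> hf hg; apply: (@is_derive_eq _ _ _ (f * g)).
by rewrite /GRing.scale/=; ring.
Qed.

Lemma is_deriveD_fun (f g : R -> R) (t df dg : R) :
  is_derive t 1 f df -> is_derive t 1 g dg ->
  is_derive t 1 (fun s => f s + g s) (df + dg).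
Proof. by move=> hf hg; apply: (@is_derive_eq _ _ _ (f + g)). Qed.

Lemma is_deriveN_fun (f : R -> R) (t df : R) :
  is_derive t 1 f df -> is_derive t 1 (fun s => - f s) (- df).
Proof. by move=> hf; apply: (@is_derive_eq _ _ _ (- f)). Qed.

(* F is differentiable at z along curves, with differential h |-> P h + Q h^* *)
Definition wirtinger F z P Q : Prop :=
  forall (g1 g2 : R -> R) (t d1 d2 : R), (g1 t, g2 t) = z ->
  is_derive t 1 g1 d1 -> is_derive t 1 g2 d2 ->
  is_derive t 1 (fun s => (F (g1 s, g2 s)).1)
    ((P.1 + Q.1) * d1 + (Q.2 - P.2) * d2) /\
  is_derive t 1 (fun s => (F (g1 s, g2 s)).2)
    ((P.2 + Q.2) * d1 + (P.1 - Q.1) * d2).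

Lemma wirtinger_partials F z P Q : wirtinger F z P Q ->
  [/\ has_partials F z, d_z F z = P & d_zbar F z = Q].
Proof.
case: z => x y FPQ.
have [xD1 xD2] := FPQ id (fun=> y) x 1 0 erefl (is_derive_id _ _) (is_derive_cst _ _ _).
have [yD1 yD2] := FPQ (fun=> x) id y 0 1 erefl (is_derive_cst _ _ _) (is_derive_id _ _).
case: xD1 xD2 yD1 yD2 => [h1 e1] [h2 e2] [h3 e3] [h4 e4].
have half (p q r : R) : p + q = r + r -> (p + q) / 2 = r.
  by move=> ->; field.
rewrite /d_z /d_zbar /partial_x /partial_y !derive1E e1 e2 e3 e4.
split.
    exact: And4 h1 h2 h3 h4.
  rewrite [RHS]surjective_pairing; apply: (congr2 pair).
    by apply: half; rewrite /=; ring.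
  by apply: half; rewrite /=; ring.
rewrite [RHS]surjective_pairing; apply: (congr2 pair).
  by apply: half; rewrite /=; ring.
by apply: half; rewrite /=; ring.
Qed.

(** Substitute [w = P h + Q conj h] in [P' w + Q' conj w] and collect terms. Since [F] sends
    differentiable curves through [z] to differentiable curves, the hypothesis on [G] applies to the
    image curve as it stands. *)
Lemma wirtinger_comp F G z P Q P' Q' :
  wirtinger F z P Q -> wirtinger G (F z) P' Q' ->
  wirtinger (G \o F) z (cmul P' P + cmul Q' (cconj Q))
    (cmul P' Q + cmul Q' (cconj P)).
Proof.
move=> FPQ GPQ g1 g2 t d1 d2 gz h1 h2.
have [k1 k2] := FPQ _ _ _ _ _ gz h1 h2.
have Fz : ((F (g1 t, g2 t)).1, (F (g1 t, g2 t)).2) = F z by rewrite gz; case: (F z).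
have [l1 l2] := GPQ _ _ _ _ _ Fz k1 k2.
have E s : (G \o F) (g1 s, g2 s) = G ((F (g1 s, g2 s)).1, (F (g1 s, g2 s)).2).
  by rewrite /=; case: (F _).
split.
  rewrite (_ : (fun s => _) = fun s => (G ((F (g1 s, g2 s)).1, (F (g1 s, g2 s)).2)).1).
    by apply: is_derive_eq l1 _; rewrite /=; ring.
  by apply/funext => s; rewrite E.
rewrite (_ : (fun s => _) = fun s => (G ((F (g1 s, g2 s)).1, (F (g1 s, g2 s)).2)).2).
  by apply: is_derive_eq l2 _; rewrite /=; ring.
by apply/funext => s; rewrite E.
Qed.

(** A differentiable curve is continuous, so near its parameter it stays where [F] and [G] agree. *)
Lemma near_eq_wirtinger F G z P Q :
  (\forall w \near z, F w = G w) -> wirtinger F z P Q -> wirtinger G z P Q.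
Proof.
move=> FG FPQ g1 g2 t d1 d2 gz h1 h2.
have [k1 k2] := FPQ _ _ _ _ _ gz h1 h2.
have c (g : R -> R) d : is_derive t 1 g d -> {for t, continuous g}.
  by move=> [/derivable1_diffP/differentiable_continuous].
have gzt : (fun s => (g1 s, g2 s)) @ t --> z.
  have c1 : g1 @ t --> g1 t := c _ _ h1.
  have c2 : g2 @ t --> g2 t := c _ _ h2.
  by rewrite -gz; apply: (@cvg_pair _ _ _ _ (nbhs (g1 t)) (nbhs (g2 t))).
have {}FG : \forall s \near t, F (g1 s, g2 s) = G (g1 s, g2 s) := gzt _ FG.
by split; [apply: near_eq_is_derive k1|apply: near_eq_is_derive k2];
  apply: filterS FG => s /= ->.
Qed.

Lemma sqr_norm_eq0 z : (z.1 ^+ 2 + z.2 ^+ 2 == 0) = (z == 0).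
Proof.
by rewrite paddr_eq0 ?sqr_ge0// !sqrf_eq0; case: z.
Qed.

Lemma wirtinger_inv z : z != 0 ->
  wirtinger (@cinv R) z (- cmul (cinv z) (cinv z)) 0.
Proof.
move=> z0 g1 g2 t d1 d2 gz h1 h2; have n0 : g1 t ^+ 2 + g2 t ^+ 2 != 0.
  by move: z0; rewrite -sqr_norm_eq0 -gz.
have hn : is_derive t 1 (fun s => g1 s ^+ 2 + g2 s ^+ 2)
    (d1 * g1 t + g1 t * d1 + (d2 * g2 t + g2 t * d2)).
  by apply: is_deriveD_fun; exact: is_deriveM_fun.
have hV := is_deriveV_fun hn n0.
rewrite -gz /cinv /=; split.
  by apply: is_derive_eq (is_deriveM_fun h1 hV) _; field.
by apply: is_derive_eq (is_deriveM_fun (is_deriveN_fun h2) hV) _; field.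
Qed.

Lemma wirtinger_conj z : wirtinger (@cconj R) z 0 (1, 0).
Proof.
move=> g1 g2 t d1 d2 gz h1 h2; split => /=.
  by apply: is_derive_eq h1 _; ring.
by apply: is_derive_eq (is_deriveN_fun h2) _; ring.
Qed.

Definition dot z w : R := z.1 * w.1 + z.2 * w.2.

(* In complex notation, with v = z - z0 and l = Re (a^* v), the differential is
   h |-> h / l^2 - v (a^* h + a h^* ) / l^3. *)
Lemma wirtinger_affine_reflection (z0 a z : R * R) :
  let v := z - z0 in dot a v != 0 ->
  wirtinger (fun w => z0 + ((w - z0).1 / dot a (w - z0) ^+ 2,
                            (w - z0).2 / dot a (w - z0) ^+ 2)) z
   (0,
    (dot a v ^+ 3)^-1 * (v.1 * a.2 - v.2 * a.1))
   (- (dot a v ^+ 3)^-1 * (v.1 * a.1 - v.2 * a.2),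
    - (dot a v ^+ 3)^-1 * (v.1 * a.2 + v.2 * a.1)).
Proof.
move=> v av g1 g2 t d1 d2 gz h1 h2.
pose v1 s := g1 s - z0.1; pose v2 s := g2 s - z0.2.
have k1 : is_derive t 1 v1 d1.
  by apply: is_derive_eq (is_deriveD_fun h1 (is_derive_cst (- z0.1) _ _)) _; rewrite addr0.
have k2 : is_derive t 1 v2 d2.
  by apply: is_derive_eq (is_deriveD_fun h2 (is_derive_cst (- z0.2) _ _)) _; rewrite addr0.
have ka (b : R) (f : R -> R) df :
    is_derive t 1 f df -> is_derive t 1 (fun s => b * f s) (b * df).
  move=> hf; apply: is_derive_eq (is_deriveM_fun (is_derive_cst b _ _) hf) _.
  by rewrite mul0r add0r.
pose l s := a.1 * v1 s + a.2 * v2 s.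
have lE : l t = dot a v by rewrite /dot /v -gz.
have kl : is_derive t 1 l (a.1 * d1 + a.2 * d2) by apply: is_deriveD_fun; exact: ka.
have l20 : l t * l t != 0 by rewrite lE mulf_neq0.
have kV := is_deriveV_fun (is_deriveM_fun kl kl) l20.
have lt0 : l t != 0 by rewrite lE.
have ev1 : v.1 = v1 t by rewrite /v -gz.
have ev2 : v.2 = v2 t by rewrite /v -gz.
rewrite -lE ev1 ev2 /dot /=; split.
  apply: is_derive_eq (is_deriveD_fun (is_derive_cst z0.1 _ _) (is_deriveM_fun k1 kV)) _.
  by move: lt0; rewrite /l => lt0; field.
apply: is_derive_eq (is_deriveD_fun (is_derive_cst z0.2 _ _) (is_deriveM_fun k2 kV)) _.
by move: lt0; rewrite /l => lt0; field.
Qed.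

End Wirtinger.

(** * Polygonal gauges and radial inversion *)

Section Gauge.
Variable R : realType.
Implicit Types (A : seq (R * R)) (a b v w z : R * R).

(** The start value 0 makes the gauge nonnegative for every list [A], and does not affect it where
    some functional is positive. *)
Definition gauge A v : R := \big[Num.max/0]_(a <- A) dot a v.

Lemma gauge_cons a A v : gauge (a :: A) v = Num.max (dot a v) (gauge A v).
Proof. by rewrite /gauge big_cons. Qed.

Lemma gauge_ge0 A v : 0 <= gauge A v.
Proof.
by elim: A => [|a A ih]; rewrite ?gauge_cons ?le_max ?ih ?orbT// /gauge big_nil.
Qed.

Lemma le_gauge A a v : a \in A -> dot a v <= gauge A v.
Proof.
elim: A => // b A ih; rewrite in_cons gauge_cons le_max => /orP[/eqP ->|/ih ->].
  by rewrite lexx.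
by rewrite orbT.
Qed.

Lemma gauge_attained A v : 0 < gauge A v ->
  exists2 a, a \in A & dot a v = gauge A v.
Proof.
elim: A => [|a A ih]; first by rewrite /gauge big_nil ltxx.
rewrite gauge_cons; case: (leP (dot a v) (gauge A v)) => h p0.
  by have [b bA bv] := ih p0; exists b => //; rewrite in_cons bA orbT.
by exists a => //; rewrite mem_head.
Qed.

Lemma dotZr a t v : dot a (t *: v) = t * dot a v.
Proof. by rewrite /dot /= /GRing.scale/=; ring. Qed.

Lemma gaugeZ A t v : 0 <= t -> gauge A (t *: v) = t * gauge A v.
Proof.
move=> t0; elim: A => [|a A ih]; first by rewrite /gauge !big_nil mulr0.
by rewrite !gauge_cons ih dotZr maxr_pMr.
Qed.

Lemma gauge_eq_dot A a v : a \in A -> 0 < dot a v ->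
  (forall b, b \in A -> dot b v <= dot a v) -> gauge A v = dot a v.
Proof.
move=> aA a0 h; apply/eqP; rewrite eq_le le_gauge// andbT.
have [->|p0] := eqVneq (gauge A v) 0; first exact: ltW.
have /gauge_attained[b bA <-] : 0 < gauge A v by rewrite lt_neqAle eq_sym p0 gauge_ge0.
exact: h.
Qed.

Lemma le_norm_coord v : `|v.1| <= `|v| /\ `|v.2| <= `|v|.
Proof. by rewrite prod_normE !le_max !lexx orbT. Qed.

Lemma gauge_le_norm A : exists2 M, 0 < M & forall v, gauge A v <= M * `|v|.
Proof.
elim: A => [|a A [M M0 AM]].
  by exists 1 => // v; rewrite /gauge big_nil mul1r.
exists (`|a.1| + `|a.2| + M) => [|v]; first by rewrite ltr_wpDl// addr_ge0.
have [v1 v2] := le_norm_coord v.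
rewrite gauge_cons ge_max mulrDl; apply/andP; split.
  apply: (@le_trans _ _ ((`|a.1| + `|a.2|) * `|v|)); last by rewrite lerDl mulr_ge0// ltW.
  rewrite mulrDl (le_trans (ler_norm _))// (le_trans (ler_normD _ _))// !normrM.
  by rewrite lerD// ler_wpM2l.
by rewrite (le_trans (AM v))// lerDr mulr_ge0// addr_ge0.
Qed.

Lemma dot_continuous a : continuous (dot a).
Proof.
move=> z; apply: cvgD; apply: cvgM; try exact: cvg_cst; [exact: cvg_fst|exact: cvg_snd].
Qed.

Lemma gauge_continuous A : continuous (gauge A).
Proof.
elim: A => [|a A ih] z.
  rewrite (_ : gauge [::] = cst 0); first exact: cvg_cst.
  by apply/funext => v; rewrite /gauge big_nil.
rewrite (_ : gauge (a :: A) = fun v => Num.max (dot a v) (gauge A v)).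
  by apply: continuous_max; [exact: dot_continuous|exact: ih].
by apply/funext => v; rewrite gauge_cons.
Qed.

Definition gauge_inv A v : R * R := (gauge A v ^+ 2)^-1 *: v.

Lemma gauge_gauge_inv A v : 0 < gauge A v ->
  gauge A (gauge_inv A v) = (gauge A v)^-1.
Proof.
move=> p0; rewrite gaugeZ ?invr_ge0 ?sqr_ge0//.
by field; rewrite gt_eqF.
Qed.

Lemma gauge_invK A v : 0 < gauge A v -> gauge_inv A (gauge_inv A v) = v.
Proof.
move=> p0; rewrite {1}/gauge_inv gauge_gauge_inv// /gauge_inv scalerA.
rewrite exprVn invrK mulfV ?scale1r//.
by rewrite sqrf_eq0 gt_eqF.
Qed.

Lemma gauge_inv_continuous A v : 0 < gauge A v ->
  {for v, continuous (gauge_inv A)}.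
Proof.
move=> p0; apply: cvgZ; last exact: cvg_id.
apply: cvgV; first by rewrite sqrf_eq0 gt_eqF.
rewrite expr2 (_ : (fun x => _) = fun x => gauge A x * gauge A x); last first.
  by apply/funext => x; rewrite expr2.
by apply: cvgM; exact: gauge_continuous.
Qed.

Lemma near_all_seq (T : eqType) (U : Type) (F : set_system U) {FF : Filter F}
    (s : seq T) (Q : T -> U -> Prop) :
  (forall i, i \in s -> \forall x \near F, Q i x) ->
  \forall x \near F, forall i, i \in s -> Q i x.
Proof.
elim: s => [|i s ih] h; first exact: nearW.
have h1 : \forall x \near F, Q i x by apply: h; exact: mem_head.
have h2 : \forall x \near F, forall j, j \in s -> Q j x.
  by apply: ih => c cs; apply: h; rewrite in_cons cs orbT.
near=> x => c; rewrite in_cons => /orP[/eqP ->|]; first by near: x.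
by move: c; near: x.
Unshelve. all: by end_near. Qed.

(** Finitely many strict inequalities between continuous functions persist nearby, so a strictly
    dominant functional stays dominant and the gauge is locally linear. *)
Lemma near_gauge_eq_dot A a v : a \in A -> 0 < dot a v ->
  (forall b, b \in A -> b != a -> dot b v < dot a v) ->
  \forall w \near v, gauge A w = dot a w.
Proof.
move=> aA a0 h.
have n0 : \forall w \near v, 0 < dot a w.
  have c : dot a @ v --> dot a v by exact: dot_continuous.
  exact: cvgr_gt c _ a0.
have n1 : \forall w \near v, forall b, b \in A -> b != a -> dot b w < dot a w.
  apply: (@near_all_seq _ _ (nbhs v) (nbhs_filter v) A
    (fun b w => b != a -> dot b w < dot a w)) => b bA.
  have [->|ba] := eqVneq b a; first exact: nearW.
  have c : (fun w => dot a w - dot b w) @ v --> dot a v - dot b v.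
    exact: cvgB (@dot_continuous a v) (@dot_continuous b v).
  have : \forall w \near v, 0 < dot a w - dot b w.
    by apply: cvgr_gt c _ _; rewrite subr_gt0 h.
  by apply: filterS => w; rewrite subr_gt0.
near=> w; apply: gauge_eq_dot => //; first by near: w.
move=> b bA; have [->//|ba] := eqVneq b a; apply: ltW; move: b bA ba.
by near: w.
Unshelve. all: by end_near. Qed.

End Gauge.

(** * Neighbourhoods of infinity; continuity of conjugation and inversion *)

Section OnePointCompactification.
Variable R : realType.
Implicit Types (z w : R * R) (s : sphere R).

(** Balls of the max norm are squares, that is, compact products of segments, so their complements
    are neighbourhoods of infinity. *)
Lemma near_infinity (P : sphere R -> Prop) :
  P None -> (exists B : R, forall w, B < `|w| -> P (Some w)) ->
  \forall s \near (None : sphere R), P s.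
Proof.
move=> PN [B PB].
exists (`[- `|B|, `|B|] `*` `[- `|B|, `|B|]).
  split; first by apply: compact_setX; exact: segment_compact.
  have -> : `[- `|B|, `|B|] `*` `[- `|B|, `|B|] =
      (fst @^-1` `[- `|B|, `|B|]) `&` (snd @^-1` `[- `|B|, `|B|]) :> set (R * R) by [].
  apply: closedI; apply: preimage_closed; try exact: interval_closed.
    by move=> x _; exact: cvg_fst.
  by move=> x _; exact: cvg_snd.
move=> s /= [[w wB <-]|->//]; apply: PB; rewrite ltNge; apply/negP => wB'.
apply: wB; have [w1 w2] := le_norm_coord w.
have {}wB' : `|w| <= `|B| := le_trans wB' (ler_norm _).
by split; rewrite /= in_itv/= -ler_norml (le_trans _ wB').
Qed.

Lemma infinity_near (U : set (sphere R)) : nbhs (None : sphere R) U ->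
  U None /\ exists B : R, forall w, B < `|w| -> U (Some w).
Proof.
move=> [C [cC _] CU]; split; first by apply: CU; right.
have [M [_ MC]] := compact_bounded cC.
(* Boundedness of [C] provides every bound strictly above [M]. *)
exists (M + 1) => w wM; apply: CU; left; exists w => // Cw.
have : `|w| <= M + 1 by apply: MC => //; rewrite ltrDl.
by rewrite leNgt wM.
Qed.

Lemma cvg_infinity (T : Type) (F : set_system T) {FF : Filter F} (h : T -> sphere R) :
  (forall B : R, \forall x \near F, forall w, h x = Some w -> B < `|w|) ->
  h @ F --> (None : sphere R).
Proof.
move=> hB U /infinity_near[UN [B UB]].
apply: filterS (hB B) => x hx /=; move: hx; case: (h x) => [w /(_ w erefl)|_ //].
exact: UB.
Qed.

Lemma sphere_conj_continuous : continuous (@sphere_conj R).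
Proof.
move=> [z|]; last first.
  move=> U /infinity_near[UN [B UB]]; apply: near_infinity => //.
  exists B => w wB; apply: UB.
  by rewrite /cconj prod_normE/= normrN -prod_normE.
move=> U nU.
have c : (@cconj R) @ z --> cconj z.
  apply: (@cvg_pair _ _ _ _ (nbhs z.1) (nbhs (- z.2))); first exact: cvg_fst.
  by apply: cvgN; exact: cvg_snd.
exact: c nU.
Qed.

Lemma sphere_conjK : involutive (@sphere_conj R).
Proof. by case=> [[x y]|] //=; rewrite /cconj/= opprK. Qed.

Lemma cinv_continuous z : z != 0 -> {for z, continuous (@cinv R)}.
Proof.
move=> z0.
have n0 : z.1 * z.1 + z.2 * z.2 != 0 by rewrite -!expr2 sqr_norm_eq0.
have c1 : (fun w => w.1) @ z --> z.1 by exact: cvg_fst.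
have c2 : (fun w => w.2) @ z --> z.2 by exact: cvg_snd.
have cn : (fun w => w.1 ^+ 2 + w.2 ^+ 2) @ z --> z.1 ^+ 2 + z.2 ^+ 2.
  by apply: cvgD; rewrite expr2; apply: cvgM.
have cV : (fun w => (w.1 ^+ 2 + w.2 ^+ 2)^-1) @ z --> (z.1 ^+ 2 + z.2 ^+ 2)^-1.
  by apply: cvgV => //; rewrite sqr_norm_eq0.
apply: (@cvg_pair _ _ _ _ (nbhs (cinv z).1) (nbhs (cinv z).2)).
  by apply: cvgM.
by apply: cvgM => //; apply: cvgN.
Qed.

Lemma cinvK z : z != 0 -> cinv (cinv z) = z.
Proof.
move=> z0; have n0 : z.1 ^+ 2 + z.2 ^+ 2 != 0 by rewrite sqr_norm_eq0.
have e : (cinv z).1 ^+ 2 + (cinv z).2 ^+ 2 = (z.1 ^+ 2 + z.2 ^+ 2)^-1 by rewrite /=; field.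
by rewrite {1}/cinv e /= [RHS]surjective_pairing; congr pair; field.
Qed.

End OnePointCompactification.

(** * Quasiconformality through the charts *)

Section Charts.
Variable R : realType.
Implicit Types (k : R) (z w : R * R) (D N U : set (R * R)) (F G : R * R -> R * R).
Local Notation mu := (@lebesgue_measure R).

(** Arbitrary Lipschitz curves, not only segments of lines, make the property stable under
    composition; horizontal and vertical segments then give ACL. *)
Definition lip_curves F D : Prop :=
  forall (a b : R) (g1 g2 : R -> R), a <= b ->
  lip_itv a b g1 -> lip_itv a b g2 ->
  (forall x, a <= x <= b -> D (g1 x, g2 x)) ->
  lip_itv a b (fun x => (F (g1 x, g2 x)).1) /\
  lip_itv a b (fun x => (F (g1 x, g2 x)).2).

Lemma lip_curves_comp F G D D' : lip_curves F D -> lip_curves G D' ->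
  lip_curves (G \o F) (D `&` F @^-1` D').
Proof.
move=> lF lG a b g1 g2 ab l1 l2 gD.
have [|k1 k2] := lF _ _ _ _ ab l1 l2; first by move=> x /gD[].
have [|m1 m2] := lG _ _ _ _ ab k1 k2.
  by move=> x /gD[_] /=; case: (F _).
by split; [apply: eq_lip_itv m1|apply: eq_lip_itv m2] => x _ /=; case: (F _).
Qed.

(** [D] omits the singular points of the formula [F], and [N] is the set where differentiability may
    fail. That [N] is null is kept apart, since it is proved separately in each chart. *)
Definition qc_off k D N F : Prop :=
  [/\ forall z, D z -> \forall w \near z, D w,
      forall z, D z -> {for z, continuous F},
      lip_curves F D &
      forall z, D z -> ~ N z ->
        exists P Q, wirtinger F z P Q /\ cmod Q <= k * cmod P].

Lemma lip_curves_cinv : lip_curves (@cinv R) [set z | z != 0].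
Proof.
move=> a b g1 g2 ab l1 l2 g0.
have ln : lip_itv a b (fun x => (g1 x ^+ 2 + g2 x ^+ 2)^-1).
  apply: lip_itvV => // [x xab|]; first by rewrite (sqr_norm_eq0 (g1 x, g2 x)) g0.
  by apply: lip_itvD; exact: lip_itvM.
by split; apply: lip_itvM => //; exact: lip_itvN.
Qed.

Lemma near_neq z w : z != w -> \forall x \near z, x != w.
Proof.
rewrite -subr_eq0 => zw.
have c : (fun x => x - w) @ z --> z - w by apply: cvgB; [exact: cvg_id|exact: cvg_cst].
near=> x; rewrite -subr_eq0; near: x; exact: (cvgr_neq0 _ c zw).
Unshelve. all: by end_near. Qed.

(** With [M] the derivative of inversion, [P] and [Q] become [P M] and [Q conj M], so the ratio of
    their moduli is unchanged. *)
Lemma qc_off_comp_cinv k D N F : qc_off k D N F ->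
  qc_off k ([set z | z != 0] `&` @cinv R @^-1` D) (@cinv R @^-1` N) (F \o @cinv R).
Proof.
move=> [oD cF lF wF]; split.
- move=> z [z0 Dz]; apply: filterI; first exact: near_neq.
  exact: (cinv_continuous z0 (oD _ Dz)).
- by move=> z [z0 Dz]; apply: continuous_comp; [exact: cinv_continuous|exact: cF].
- exact: lip_curves_comp lip_curves_cinv lF.
- move=> z [z0 Dz] Nz; have [P [Q [wPQ PQ]]] := wF _ Dz Nz.
  have := wirtinger_comp (wirtinger_inv z0) wPQ.
  set M := - _ => wc; eexists; eexists; split; first exact: wc.
  have e1 : cmul P M + cmul Q (cconj 0) = cmul P M.
    by rewrite /cconj/= /cmul/= oppr0 !mulr0 addr0 subr0 addr0.
  have e2 : cmul P 0 + cmul Q (cconj M) = cmul Q (cconj M).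
    by rewrite {1}/cmul/= !mulr0 addr0 subr0 add0r.
  by rewrite e1 e2 !cmodM cmod_conj mulrA ler_wpM2r// cmod_ge0.
Qed.

(** Holomorphic postcomposition multiplies both coefficients by the same factor. *)
Lemma qc_off_cinv_comp k D N F : qc_off k D N F ->
  qc_off k (D `&` F @^-1` [set z | z != 0]) N (@cinv R \o F).
Proof.
move=> [oD cF lF wF]; split.
- move=> z [Dz z0]; apply: filterI; first exact: oD.
  exact: (cF z Dz _ (near_neq z0)).
- by move=> z [Dz z0]; apply: continuous_comp; [exact: cF|exact: cinv_continuous].
- exact: lip_curves_comp lF lip_curves_cinv.
- move=> z [Dz z0] Nz; have [P [Q [wPQ PQ]]] := wF _ Dz Nz.
  have := wirtinger_comp wPQ (wirtinger_inv z0).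
  set M := - _ => wc; eexists; eexists; split; first exact: wc.
  have e1 w : cmul 0 w = 0 by rewrite /cmul/= !mul0r addr0 subr0.
  by rewrite !e1 !addr0 !cmodM mulrCA ler_wpM2l// cmod_ge0.
Qed.

Lemma negligible_seq (T : eqType) (s : seq T) (N : T -> set (R * R)) :
  (forall i, i \in s -> (mu \x mu)%E.-negligible (N i)) ->
  (mu \x mu)%E.-negligible [set z | exists2 i, i \in s & N i z].
Proof.
elim: s => [|i s ih] h.
  by apply: negligibleS (negligible_set0 _) => z [].
apply: negligibleS (negligibleU (h i (mem_head _ _)) (ih _)) => [z [j]|j js].
  by rewrite in_cons => /orP[/eqP ->|js]; [left|right; exists j].
by apply: h; rewrite in_cons js orbT.
Qed.

(** The point is the circle [|z - w|^2 = 0] of radius 0. *)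
Lemma negligible_point w : (mu \x mu)%E.-negligible [set w].
Proof.
apply: negligibleS (@circle_negligible _ 1 (- 2 * w.1) (- 2 * w.2)
  (w.1 ^+ 2 + w.2 ^+ 2) _) => [z ->/=|[/eqP]]; first by ring.
by rewrite oner_eq0.
Qed.

Lemma ae_notin (E : seq R) : {ae mu, forall y, y \notin E}.
Proof.
have cE : countable [set` E] by exact/finite_set_countable/finite_seq.
exists [set` E]; split; [exact: countable_measurable|exact: countable_lebesgue_measure0|].
by move=> y /= /negP; rewrite negbK.
Qed.

(* Almost every horizontal or vertical line avoids the finitely many points of E. *)
Lemma qc_off_ACL k D N F U f (E : seq (R * R)) : qc_off k D N F ->
  (forall z, U z -> z \notin E -> D z) -> (forall z, D z -> f z = F z) ->
  ACL U f.
Proof.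
move=> [_ _ lF _] UD fF a b c d ab cd abU.
have UE z : U z -> z.1 \notin map fst E \/ z.2 \notin map snd E -> D z.
  move=> Uz h; apply: UD => //; apply/negP => zE.
  by case: h => /negP; apply; apply: map_f.
split.
  apply: negligibleS (ae_notin (map snd E)) => y.
  apply: contra_not => yE /=; rewrite inE/= => ycd.
  have Dy x : a <= x <= b -> D (x, y).
    by move=> xab; apply: UE; [apply: abU; split; rewrite /= in_itv|right].
  have [l1 l2] := lF a b id (fun=> y) (ltW ab) (lip_itv_id _ _) (lip_itv_cst _ _ _) Dy.
  by split; apply: lip_itv_absolutely_continuous;
    [apply: eq_lip_itv l1|apply: eq_lip_itv l2] => x /Dy /fF ->.
apply: negligibleS (ae_notin (map fst E)) => x.
apply: contra_not => xE /=; rewrite inE/= => xab.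
have Dx y : c <= y <= d -> D (x, y).
  by move=> ycd; apply: UE; [apply: abU; split; rewrite /= in_itv|left].
have [l1 l2] := lF c d (fun=> x) id (ltW cd) (lip_itv_cst _ _ _) (lip_itv_id _ _) Dx.
by split; apply: lip_itv_absolutely_continuous;
  [apply: eq_lip_itv l1|apply: eq_lip_itv l2] => y /Dx /fF ->.
Qed.

(** The domain [U] of the actual map [f] may exceed that of the formula [F] by the finite set [E],
    which harms neither ACL nor an almost everywhere statement. As [D] is open, [f] inherits the
    derivatives of [F] there. *)
Lemma qc_off_analytic_qc (K : R) D N F U f (E : seq (R * R)) :
  qc_off ((K - 1) / (K + 1)) D N F -> (mu \x mu)%E.-negligible N ->
  (forall z, U z -> z \notin E -> D z) -> (forall z, D z -> f z = F z) ->
  analytic_qc K U f.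
Proof.
move=> qF N0 UD fF; split; first exact: qc_off_ACL qF UD fF.
have [oD _ _ wF] := qF.
have NE : (mu \x mu)%E.-negligible (N `|` [set z | exists2 w, w \in E & [set w] z]).
  by apply: negligibleU => //; apply: negligible_seq => w _; exact: negligible_point.
apply: negligibleS NE => z /= /not_implyP[Uz]; apply: contra_notP => /not_orP[Nz Ez].
have Dz : D z.
  by apply: UD => //; apply/negP => zE; apply: Ez; exists z.
have [P [Q [wPQ PQ]]] := wF _ Dz Nz.
have fPQ : wirtinger f z P Q.
  by apply: near_eq_wirtinger wPQ; apply: filterS (oD _ Dz) => w /fF ->.
by have [hp -> ->] := wirtinger_partials fPQ.
Qed.

End Charts.

(** * The star reflection in the plane *)

Section StarReflection.
Variable R : realType.
Implicit Types (A : seq (R * R)) (a b v w z : R * R) (m tau : R).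
Local Notation mu := (@lebesgue_measure R).

Definition star_refl A z0 z : R * R := z0 + gauge_inv A (z - z0).

Definition sphere_refl A z0 (s : sphere R) : sphere R :=
  if s is Some z then (if z == z0 then None else Some (star_refl A z0 z))
  else Some z0.

Definition gauge_pos A : Prop := forall v, v != 0 -> 0 < gauge A v.

Definition ties A : seq ((R * R) * (R * R)) :=
  [seq p <- [seq (a, b) | a <- A, b <- A] | p.1 != p.2].

(** Whole lines through [z0], containing the rays that separate the sectors: only nullity matters,
    and lines have simpler equations. *)
Definition tie_set A z0 : set (R * R) :=
  [set z | exists2 p, p \in ties A & dot p.1 (z - z0) = dot p.2 (z - z0)].

Lemma star_refl_continuous A z0 z : gauge_pos A -> z != z0 ->
  {for z, continuous (star_refl A z0)}.
Proof.
move=> Apos zz0; have p0 : 0 < gauge A (z - z0) by rewrite Apos ?subr_eq0.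
apply: cvgD; first exact: cvg_cst.
apply: (@continuous_comp _ _ _ (fun z => z - z0) (gauge_inv A)).
  by apply: cvgB; [exact: cvg_id|exact: cvg_cst].
exact: gauge_inv_continuous.
Qed.

(** Along a Lipschitz curve the gauge is a finite maximum of Lipschitz functions, and it is positive
    off the centre, so its inverse square is Lipschitz too. *)
Lemma lip_curves_star_refl A z0 : gauge_pos A ->
  lip_curves (star_refl A z0) [set z | z != z0].
Proof.
move=> Apos a b g1 g2 ab l1 l2 gz0.
have k1 : lip_itv a b (fun x => g1 x - z0.1) by apply: lip_itvD => //; exact: lip_itv_cst.
have k2 : lip_itv a b (fun x => g2 x - z0.2) by apply: lip_itvD => //; exact: lip_itv_cst.
have lp : lip_itv a b (fun x => gauge A ((g1 x, g2 x) - z0)).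
  apply: lip_itv_bigmax => c; apply: lip_itvD; apply: lip_itvM => //; exact: lip_itv_cst.
have lV : lip_itv a b (fun x => (gauge A ((g1 x, g2 x) - z0) ^+ 2)^-1).
  apply: lip_itvV => // [x xab|]; last exact: lip_itvM.
  by rewrite sqrf_eq0 gt_eqF// Apos// subr_eq0; exact: gz0.
split; apply: lip_itvD; try exact: lip_itv_cst.
  exact: lip_itvM lV k1.
exact: lip_itvM lV k2.
Qed.

Lemma star_refl_wirtinger A z0 z : gauge_pos A -> z != z0 -> ~ tie_set A z0 z ->
  exists2 a, a \in A & [/\ dot a (z - z0) = gauge A (z - z0) &
  let v := z - z0 in
  wirtinger (star_refl A z0) z
   (0, (dot a v ^+ 3)^-1 * (v.1 * a.2 - v.2 * a.1))
   (- (dot a v ^+ 3)^-1 * (v.1 * a.1 - v.2 * a.2),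
    - (dot a v ^+ 3)^-1 * (v.1 * a.2 + v.2 * a.1))].
Proof.
move=> Apos zz0 Tz; have p0 : 0 < gauge A (z - z0) by rewrite Apos ?subr_eq0.
have [a aA av] := gauge_attained p0; exists a => //; split=> // v.
have a0 : 0 < dot a v by rewrite av.
apply: near_eq_wirtinger (wirtinger_affine_reflection _); last by rewrite gt_eqF.
have h : \forall w \near v, gauge A w = dot a w.
  apply: (near_gauge_eq_dot aA a0) => b bA ba.
  rewrite lt_neqAle {2}av le_gauge// andbT; apply/eqP => bav; apply: Tz.
  exists (b, a) => //; rewrite mem_filter ba/=.
  by apply/allpairsP; exists (b, a).
have c : (fun w => w - z0) @ z --> v by apply: cvgB; [exact: cvg_id|exact: cvg_cst].
have {}h : \forall w \near z, gauge A (w - z0) = dot a (w - z0) := c _ h.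
near=> w; rewrite /star_refl /gauge_inv.
have -> : gauge A (w - z0) = dot a (w - z0) by near: w.
by congr (_ + (_, _)); rewrite /GRing.scale/= mulrC.
Unshelve. all: by end_near. Qed.

(** Up to the common factor [q^2] and clearing of denominators, the squares compare as
    [x^2 (1 + tau^2) <= tau^2 (l^2 + x^2)], that is, [x^2 <= tau^2 l^2]. *)
Lemma sqrt_dilatation (tau l x q : R) : 0 <= tau -> `|x| <= tau * l ->
  Num.sqrt (q ^+ 2 * x ^+ 2) <=
  tau / Num.sqrt (1 + tau ^+ 2) * Num.sqrt (q ^+ 2 * (l ^+ 2 + x ^+ 2)).
Proof.
move=> tau0 xl; have s0 : 0 < 1 + tau ^+ 2 by rewrite ltr_wpDr// sqr_ge0.
have -> : tau / Num.sqrt (1 + tau ^+ 2) = Num.sqrt (tau ^+ 2 / (1 + tau ^+ 2)).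
  by rewrite sqrtrM ?sqr_ge0// sqrtr_sqr ger0_norm// sqrtrV// ltW.
have r0 : 0 <= tau ^+ 2 / (1 + tau ^+ 2) by rewrite divr_ge0 ?sqr_ge0// ltW.
rewrite -sqrtrM//; apply: ler_wsqrtr.
rewrite [leRHS]mulrCA ler_wpM2l ?sqr_ge0// [leRHS]mulrAC ler_pdivlMr//.
have : x ^+ 2 <= (tau * l) ^+ 2.
  by rewrite -real_normK ?num_real// ler_sqr// nnegrE (le_trans _ xl).
by rewrite exprMn => h; rewrite mulrDr mulr1 mulrDr (mulrC (x ^+ 2)) lerD2r.
Qed.

(** Conjugation exchanges the moduli of the two coefficients. With [l = dot a v] and [x] the cross
    product, their ratio becomes [|x| / sqrt (l^2 + x^2)], the cosine of the angle between radius
    and side; [tau] bounds the cotangent [|x| / l]. *)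
Lemma qc_off_star_refl A z0 tau k : gauge_pos A -> 0 <= tau ->
  k = tau / Num.sqrt (1 + tau ^+ 2) ->
  (forall a v, a \in A -> dot a v = gauge A v ->
     `|v.1 * a.2 - v.2 * a.1| <= tau * dot a v) ->
  qc_off k [set z | z != z0] (tie_set A z0) (@cconj R \o star_refl A z0).
Proof.
move=> Apos tau0 -> cone; split.
- by move=> z; exact: near_neq.
- move=> z zz0; apply: continuous_comp; first exact: star_refl_continuous.
  apply: (@cvg_pair _ _ _ _ (nbhs (star_refl A z0 z).1) (nbhs (- (star_refl A z0 z).2))).
    exact: cvg_fst.
  by apply: cvgN; exact: cvg_snd.
- move=> a b g1 g2 ab l1 l2 gD.
  have [k1 k2] := lip_curves_star_refl Apos ab l1 l2 gD.
  by split => //=; exact: lip_itvN.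
- move=> z zz0 Tz.
  have [a aA [av waff]] := star_refl_wirtinger Apos zz0 Tz.
  have {waff} := wirtinger_comp waff (@wirtinger_conj _ _).
  set v := z - z0 in av *; set l := dot a v in av *.
  set x := v.1 * a.2 - v.2 * a.1 => wc.
  eexists; eexists; split; first exact: wc.
  have l0 : 0 < l by rewrite av Apos// subr_eq0.
  have xl : `|x| <= tau * l by exact: cone.
  rewrite /cmod /cmul/= !(mul0r, mulr0, mul1r, oppr0, addr0, add0r, subr0).
  set q := (l ^+ 3)^-1.
  (* The complex product [v a] has squared modulus [|v|^2 |a|^2], which is [l^2 + x^2] by the
     Lagrange identity. *)
  have -> : (- q * (v.1 * a.1 - v.2 * a.2)) ^+ 2 + (- (- q * (v.1 * a.2 + v.2 * a.1))) ^+ 2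
    = q ^+ 2 * (l ^+ 2 + x ^+ 2) by rewrite /l /x /dot; ring.
  by rewrite expr0n/= add0r sqrrN exprMn sqrt_dilatation.
Qed.

End StarReflection.

(** * The star reflection on the sphere *)

Section SphereReflection.
Variable R : realType.
Implicit Types (A : seq (R * R)) (a b v w z : R * R) (s : sphere R).
Local Notation mu := (@lebesgue_measure R).

Lemma tie_set_negligible A z0 : (mu \x mu)%E.-negligible (tie_set A z0).
Proof.
apply: negligible_seq => -[a b]; rewrite mem_filter => /andP[/= ab _].
apply: negligibleS (@circle_negligible _ 0 (a.1 - b.1) (a.2 - b.2)
  (dot b z0 - dot a z0) _) => [z /= e|[_ e1 e2 _]].
  transitivity (dot a (z - z0) - dot b (z - z0)); last by rewrite e subrr.
  by rewrite /dot/=; ring.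
case/negP: ab; case: a b e1 e2 => [a1 a2] [b1 b2] /= /eqP + /eqP.
by rewrite !subr_eq0 => /eqP -> /eqP ->.
Qed.

(** Multiplying the equation of a tie line at [cinv z] by [|z|^2] gives the equation of a circle or
    line. The origin is set aside because [cinv 0 = 0] is only a convention. *)
Lemma tie_set_cinv_negligible A z0 :
  (mu \x mu)%E.-negligible (@cinv R @^-1` tie_set A z0).
Proof.
pose N (p : (R * R) * (R * R)) := [set z | z != 0 /\
  dot p.1 (cinv z - z0) = dot p.2 (cinv z - z0)].
have N0 : (mu \x mu)%E.-negligible [set z | exists2 p, p \in ties A & N p z].
  apply: negligible_seq => -[a b]; rewrite mem_filter => /andP[/= ab _].
  apply: negligibleS (@circle_negligible _ (dot b z0 - dot a z0) (a.1 - b.1) (b.2 - a.2)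
    0 _) => [z /= [zn0 e]|[_ e1 e2 _]].
    have n0 : z.1 ^+ 2 + z.2 ^+ 2 != 0 by rewrite sqr_norm_eq0.
    transitivity ((z.1 ^+ 2 + z.2 ^+ 2) *
      (dot a (cinv z - z0) - dot b (cinv z - z0))); last by rewrite e subrr mulr0.
    by rewrite /dot/=; field.
  case/negP: ab; case: a b e1 e2 => [a1 a2] [b1 b2] /= /eqP + /eqP.
  by rewrite !subr_eq0 => /eqP -> /eqP ->.
apply: negligibleS (negligibleU (negligible_point 0) N0) => z [p pA pz].
by have [->|z0'] := eqVneq z 0; [left|right; exists p].
Qed.

Lemma sphere_inv_Some z : z != 0 -> sphere_inv (Some z) = Some (cinv z).
Proof. by rewrite /sphere_inv => /negbTE z0; rewrite [z == _]z0. Qed.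

Lemma sphere_refl_Some A z0 z : z != z0 ->
  sphere_refl A z0 (Some z) = Some (star_refl A z0 z).
Proof. by rewrite /sphere_refl => /negbTE ->. Qed.

(** In each chart [E] lists the points where the map may be finite although its formula passes
    through infinity: 0 if the source is inverted, [z0] if the target is, and for both 0 and the
    point [cinv z0] lying over [z0]. *)
Lemma star_refl_analytic_qc A z0 (K : R) (h := @sphere_conj R \o sphere_refl A z0) :
  qc_off ((K - 1) / (K + 1)) [set z | z != z0] (tie_set A z0)
    (@cconj R \o star_refl A z0) ->
  let qc g := analytic_qc K (finite_dom g) (finite_part g) in
  [/\ qc h, qc (h \o @sphere_inv R), qc (@sphere_inv R \o h) &
      qc (@sphere_inv R \o h \o @sphere_inv R)].
Proof.
move=> qch qc.
have hE z : z != z0 -> h (Some z) = Some ((@cconj R \o star_refl A z0) z).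
  by move=> zz0; rewrite /h /= [if _ then _ else _]sphere_refl_Some.
have hN : h (Some z0) = None by rewrite /h/= eqxx.
have T1 := tie_set_negligible A z0; have T2 := tie_set_cinv_negligible A z0.
rewrite {}/qc; split.
- apply: (qc_off_analytic_qc (E := [::]) qch T1) => z.
    by move=> Uz _ /=; apply/eqP => zz0; apply: Uz; rewrite zz0.
  by move=> /= zz0; rewrite /finite_part hE.
- apply: (qc_off_analytic_qc (E := [:: 0]) (qc_off_comp_cinv qch) T2) => z.
    rewrite inE => Uz zn0; split => //=; apply/eqP => zz0; apply: Uz.
    by rewrite [LHS]/= -[if _ then _ else _]/(sphere_inv (Some z)) sphere_inv_Some// zz0.
  move=> [/= zn0 zz0].
  rewrite /finite_part [(h \o _) _]/= -[if _ then _ else _]/(sphere_inv (Some z)).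
  by rewrite sphere_inv_Some// hE.
- apply: (qc_off_analytic_qc (E := [:: z0]) (qc_off_cinv_comp qch) T1) => z.
    rewrite inE => Uz zz0; split => //=; apply/eqP => e0; apply: Uz.
    by rewrite /= hE// /= e0 /sphere_inv eqxx.
  move=> [/= zz0 zn0].
  by rewrite /finite_part [(_ \o _) _]/= hE// sphere_inv_Some.
- apply: (qc_off_analytic_qc (E := [:: 0; cinv z0])
    (qc_off_cinv_comp (qc_off_comp_cinv qch)) T2) => z.
    rewrite !inE negb_or => Uz /andP[zn0 zcz0].
    have zz0 : cinv z != z0 by apply: contraNneq zcz0 => <-; rewrite cinvK.
    split => //; apply/eqP => e0; apply: Uz.
    have {}e0 : (@cconj R \o star_refl A z0) (cinv z) = 0 := e0.
    rewrite [LHS]/= -[if z == _ then _ else _]/(sphere_inv (Some z)).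
    by rewrite sphere_inv_Some// hE// e0 /sphere_inv eqxx.
  move=> [[/= zn0 zz0] hn0].
  rewrite /finite_part [(_ \o _) _]/= -[if z == _ then _ else _]/(sphere_inv (Some z)).
  by rewrite sphere_inv_Some// hE// sphere_inv_Some.
Qed.

Lemma gauge_lb_pos A m : 0 < m -> (forall v, m * `|v| <= gauge A v) -> gauge_pos A.
Proof. by move=> m0 mA v v0; apply: lt_le_trans (mA v); rewrite mulr_gt0 ?normr_gt0. Qed.

Lemma sphere_reflK A z0 : gauge_pos A -> involutive (sphere_refl A z0).
Proof.
move=> Apos [z|]; last by rewrite /= eqxx.
have [->|zz0] := eqVneq z z0; first by rewrite /= eqxx.
have vn0 : z - z0 != 0 by rewrite subr_eq0.
have p0 := Apos _ vn0.
rewrite sphere_refl_Some// /star_refl.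
have gn0 : gauge_inv A (z - z0) != 0.
  by rewrite /gauge_inv scaler_eq0 negb_or vn0 andbT invr_eq0 sqrf_eq0 gt_eqF.
rewrite sphere_refl_Some; last by rewrite -subr_eq0 addrAC subrr add0r.
by rewrite /star_refl [z0 + _ - z0]addrAC subrr add0r gauge_invK// addrC subrK.
Qed.

Lemma norm_gauge_inv A v : `|gauge_inv A v| = `|v| / gauge A v ^+ 2.
Proof.
by rewrite /gauge_inv normrZ ger0_norm ?invr_ge0 ?sqr_ge0// mulrC.
Qed.

Lemma norm_gauge_inv_le A m v : 0 < m -> m * `|v| <= gauge A v ->
  v != 0 -> `|gauge_inv A v| <= (m ^+ 2 * `|v|)^-1.
Proof.
move=> m0 mv v0; have n0 : 0 < `|v| by rewrite normr_gt0.
have p0 : 0 < gauge A v by apply: lt_le_trans mv; rewrite mulr_gt0.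
rewrite norm_gauge_inv ler_pdivrMr ?exprn_gt0//.
rewrite mulrC ler_pdivlMr ?mulr_gt0 ?exprn_gt0//.
rewrite (_ : `|v| * _ = (m * `|v|) ^+ 2); last by ring.
by rewrite ler_sqr// nnegrE ltW// mulr_gt0.
Qed.

Lemma norm_gauge_inv_ge A M v : 0 < M -> gauge A v <= M * `|v| ->
  0 < gauge A v -> (M ^+ 2 * `|v|)^-1 <= `|gauge_inv A v|.
Proof.
move=> M0 Mv p0.
have n0 : 0 < `|v| by rewrite -(pmulr_rgt0 _ M0); exact: lt_le_trans Mv.
rewrite norm_gauge_inv ler_pdivlMr ?exprn_gt0// mulrC ler_pdivrMr ?mulr_gt0 ?exprn_gt0//.
rewrite (_ : `|v| * _ = (M * `|v|) ^+ 2); last by ring.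
by rewrite ler_sqr// nnegrE ltW// mulr_gt0.
Qed.

(** At infinity and at [z0] the gauge is compared with the norm, by the lower bound [m] and the
    upper bound of [gauge_le_norm] respectively: the reflection behaves like [1 / |v|] up to
    constants. *)
Lemma sphere_refl_continuous A z0 m : 0 < m -> (forall v, m * `|v| <= gauge A v) ->
  continuous (sphere_refl A z0).
Proof.
move=> m0 mA; have Apos := gauge_lb_pos m0 mA.
move=> [z|]; last first.
  move=> U /nbhs_ballP[e /= e0 eU].
  apply: near_infinity; first exact: (eU _ (ballxx _ e0)).
  (* Beyond this radius [|w - z0| > 1 / (m^2 e)], so the image lies within [e] of [z0]. *)
  exists (`|z0| + (m ^+ 2 * e)^-1) => w wB.
  have me0 : 0 < m ^+ 2 * e by rewrite mulr_gt0 ?exprn_gt0.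
  have vB : (m ^+ 2 * e)^-1 < `|w - z0|.
    by rewrite -(ltrD2l `|z0|) (lt_le_trans wB)// -{1}(subrK z0 w) addrC ler_normD.
  have v0 : w - z0 != 0 by rewrite -normr_gt0 (lt_trans _ vB)// invr_gt0.
  suff : U (sphere_refl A z0 (Some w)) by [].
  have wz0 : w != z0 by rewrite -subr_eq0.
  rewrite (sphere_refl_Some A wz0); apply: eU.
  rewrite -ball_normE /= /star_refl opprD addrA subrr sub0r normrN.
  rewrite (le_lt_trans (norm_gauge_inv_le m0 (mA _) v0))//.
  rewrite -ltf_pV2 ?posrE ?invr_gt0 ?mulr_gt0 ?exprn_gt0 ?normr_gt0// invrK.
  by move: vB; rewrite invfM -ltr_pdivrMl ?exprn_gt0// mulrC.
have [->|zz0] := eqVneq z z0.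
  suff : (sphere_refl A z0 \o Some) @ z0 --> sphere_refl A z0 (Some z0) by [].
  rewrite (_ : sphere_refl A z0 (Some z0) = None); last by rewrite /sphere_refl eqxx.
  apply: cvg_infinity => B.
  have [M M0 AM] := gauge_le_norm A.
  (* Within [1 / (M^2 C)] of the centre, [gauge_inv] exceeds [C] in norm; adding [z0] costs at most
     [|z0|] and leaves more than [B]. *)
  pose C := `|B| + `|z0| + 1; have C0 : 0 < C by rewrite ltr_wpDl// addr_ge0.
  have d0 : 0 < (M ^+ 2 * C)^-1 by rewrite invr_gt0 mulr_gt0// exprn_gt0.
  near=> x => w /=; case: ifPn => // xz0 [<-].
  have v0 : x - z0 != 0 by rewrite subr_eq0.
  have vd : `|x - z0| < (M ^+ 2 * C)^-1.
    by rewrite distrC; near: x; exact: (@cvgr_dist_lt _ _ _ (nbhs z0) _ id z0).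
  have h := norm_gauge_inv_ge M0 (AM _) (Apos _ v0).
  have CM : C < (M ^+ 2 * `|x - z0|)^-1.
    rewrite -ltf_pV2 ?posrE ?invr_gt0 ?mulr_gt0 ?exprn_gt0 ?normr_gt0// invrK.
    by move: vd; rewrite invfM -ltr_pdivlMl ?invr_gt0 ?exprn_gt0// invrK.
  have : C - `|z0| < `|star_refl A z0 x|.
    rewrite ltrBlDr (lt_le_trans CM)// (le_trans h)//.
    by rewrite -{1}(addrK z0 (gauge_inv A _)) (addrC _ z0) (le_trans (ler_normB _ _)).
  by apply: le_lt_trans; rewrite /C; have := ler_norm B; lra.
have c : (fun w => Some (star_refl A z0 w) : sphere R) @ z -->
    (Some (star_refl A z0 z) : sphere R).
  apply: (@continuous_comp _ _ _ (star_refl A z0) (Some : R * R -> sphere R)).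
    exact: star_refl_continuous.
  exact: one_point_compactification_some_continuous.
suff : (sphere_refl A z0 \o Some) @ z --> sphere_refl A z0 (Some z) by [].
rewrite (sphere_refl_Some A zz0); apply: cvg_trans c; apply: near_eq_cvg.
by apply: filterS (near_neq zz0) => w wz0; rewrite [RHS]/= (negbTE wz0).
Unshelve. all: by end_near. Qed.

Lemma sphere_refl_homeomorphism A z0 m : 0 < m -> (forall v, m * `|v| <= gauge A v) ->
  homeomorphism (@sphere_conj R \o sphere_refl A z0).
Proof.
move=> m0 mA; have cr := sphere_refl_continuous (z0 := z0) m0 mA.
have rK := sphere_reflK z0 (gauge_lb_pos m0 mA).
split; first by move=> s; apply: continuous_comp; [exact: cr|exact: sphere_conj_continuous].
exists (sphere_refl A z0 \o @sphere_conj R); split.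
- by move=> s; apply: continuous_comp; [exact: sphere_conj_continuous|exact: cr].
- by move=> s /=; rewrite sphere_conjK rK.
- by move=> s /=; rewrite rK sphere_conjK.
Qed.

End SphereReflection.

(** * Inner and outer domain of the curve *)

Section StarDomain.
Variable R : realType.
Implicit Types (A : seq (R * R)) (a b v w z : R * R) (s : sphere R) (m : R).

Definition gauge_circle A z0 : set (R * R) := [set z | gauge A (z - z0) = 1].

Lemma gauge_shift_continuous A z0 : continuous (fun z => gauge A (z - z0)).
Proof.
move=> z; apply: (@continuous_comp _ _ _ (fun z => z - z0) (gauge A)).
  by apply: cvgB; [exact: cvg_id|exact: cvg_cst].
exact: gauge_continuous.
Qed.

(** The gauge maps the component onto an interval that misses 1, so it stays below 1 there; the
    lower bound on the gauge then bounds the component. *)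
Lemma component_inside A z0 m z : 0 < m -> (forall v, m * `|v| <= gauge A v) ->
  gauge A (z - z0) < 1 ->
  bounded_set (connected_component (~` gauge_circle A z0) z).
Proof.
move=> m0 mA z1; set C := connected_component _ _.
have cC : connected C by exact: component_connected.
have Cz : C z.
  apply: connected_component_refl; rewrite /gauge_circle/= => e.
  by move: z1; rewrite e ltxx.
have C1 w : C w -> gauge A (w - z0) < 1.
  move=> Cw; rewrite ltNge; apply/negP => w1.
  have /connected_intervalP iC : connected ((fun z => gauge A (z - z0)) @` C).
    apply: connected_continuous_connected => //.
    by apply: continuous_subspaceT; exact: gauge_shift_continuous.
  have z1w : gauge A (z - z0) <= 1 <= gauge A (w - z0) by rewrite w1 ltW.
  have [x Cx x1] := iC _ _ (imageP _ Cz) (imageP _ Cw) 1 z1w.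
  by have := connected_component_sub Cx; apply.
exists (`|z0| + m^-1); split; first exact: num_real.
move=> M MB w Cw /=; rewrite (le_trans _ (ltW MB))//.
rewrite -{1}(subrK z0 w) addrC (le_trans (ler_normD _ _))// lerD2l.
rewrite -(ler_pM2l m0) mulfV ?gt_eqF//.
exact: le_trans (mA _) (ltW (C1 _ Cw)).
Qed.

(** The ray from [z] away from [z0] has gauge above 1 throughout, so it lies in the component. *)
Lemma component_outside A z0 z : 1 < gauge A (z - z0) ->
  ~ bounded_set (connected_component (~` gauge_circle A z0) z).
Proof.
move=> z1 [M [_ MB]]; set v := z - z0 in z1.
have v0 : 0 < `|v|.
  rewrite normr_gt0; apply/eqP => v0; move: z1.
  have [B _ /(_ v)] := gauge_le_norm A.
  by rewrite v0 normr0 mulr0 => h /(lt_le_trans)/(_ h); rewrite ltr10.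
pose ray := (fun t : R => z0 + t *: v) @` `[1, +oo[.
have cray : connected ray.
  apply: connected_continuous_connected.
    by apply/connected_intervalP; exact: interval_is_interval.
  apply: continuous_subspaceT => t; apply: cvgD; first exact: cvg_cst.
  by apply: cvgZr_tmp; exact: cvg_id.
have rayC : ray `<=` connected_component (~` gauge_circle A z0) z.
  apply: connected_component_max => //.
    exists 1; first by rewrite /= in_itv/= lexx.
    by rewrite scale1r addrC subrK.
  move=> _ [t /= + <-]; rewrite in_itv/= andbT => t1.
  rewrite /gauge_circle/= addrAC subrr add0r gaugeZ ?(le_trans _ t1)// => e.
  have : 1 < t * gauge A v by rewrite (lt_le_trans z1)// ler_peMl// gauge_ge0.
  by rewrite e ltxx.
(* Chosen so that [t |v| = |M| + 1 + |z0| + |v|]. *)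
pose t : R := (`|M| + 1 + `|z0|) / `|v| + 1.
have t1 : 1 <= t by rewrite lerDr divr_ge0// !addr_ge0.
have : `|z0 + t *: v| <= `|M| + 1.
  apply: MB; first by rewrite (le_lt_trans (ler_norm _))// ltrDl.
  by apply: rayC; exists t => //; rewrite /= in_itv/= t1.
apply/negP; rewrite -ltNge.
have : `|t *: v| - `|z0| <= `|z0 + t *: v|.
  by rewrite lerBlDl -{1}(addKr z0 (t *: v)) (le_trans (ler_normD _ _))// normrN.
apply: lt_le_trans; rewrite ltrBrDr normrZ ger0_norm ?(le_trans _ t1)//.
by rewrite /t mulrDl divfK ?gt_eqF// mul1r ltrDl.
Qed.

Lemma inner_domainE A z0 m : 0 < m -> (forall v, m * `|v| <= gauge A v) ->
  inner_domain (gauge_circle A z0) = Some @` [set z | gauge A (z - z0) < 1].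
Proof.
move=> m0 mA; apply/seteqP; split=> _ [z /= hz <-]; exists z => //=.
  case: hz => nL bd; rewrite ltNge; apply/negP => z1; apply: (component_outside _ bd).
  by rewrite lt_neqAle z1 andbT eq_sym; apply/eqP.
split; first by rewrite /gauge_circle/= => e; move: hz; rewrite e ltxx.
exact: component_inside mA hz.
Qed.

Lemma outer_domainE A z0 m : 0 < m -> (forall v, m * `|v| <= gauge A v) ->
  outer_domain (gauge_circle A z0) =
  None |` (Some @` [set z | 1 < gauge A (z - z0)]).
Proof.
move=> m0 mA; rewrite /outer_domain; congr (_ `|` _).
apply/seteqP; split=> _ [z /= hz <-]; exists z => //=.
  case: hz => nL bd; rewrite ltNge; apply/negP => z1; apply: bd.
  apply: component_inside mA _ => //; rewrite lt_neqAle z1 andbT; exact/eqP.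
split; first by rewrite /gauge_circle/= => e; move: hz; rewrite e ltxx.
exact: component_outside.
Qed.

Lemma gauge_star_refl A z0 z : gauge_pos A -> z != z0 ->
  gauge A (star_refl A z0 z - z0) = (gauge A (z - z0))^-1.
Proof.
move=> Apos zz0; rewrite /star_refl addrAC subrr add0r gauge_gauge_inv//.
by rewrite Apos// subr_eq0.
Qed.

Lemma sphere_refl_inner A z0 m : 0 < m -> (forall v, m * `|v| <= gauge A v) ->
  sphere_refl A z0 @` inner_domain (gauge_circle A z0) `<=`
  outer_domain (gauge_circle A z0).
Proof.
move=> m0 mA; have Apos := gauge_lb_pos m0 mA.
rewrite (inner_domainE z0 m0 mA) (outer_domainE z0 m0 mA) => _ [_ [z /= z1 <-] <-].
have [->|zz0] := eqVneq z z0; first by left; rewrite /= eqxx.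
right; exists (star_refl A z0 z); last by rewrite sphere_refl_Some.
by rewrite /= gauge_star_refl// invf_gt1// Apos// subr_eq0.
Qed.

Lemma sphere_refl_outer A z0 m : 0 < m -> (forall v, m * `|v| <= gauge A v) ->
  sphere_refl A z0 @` outer_domain (gauge_circle A z0) `<=`
  inner_domain (gauge_circle A z0).
Proof.
move=> m0 mA; have Apos := gauge_lb_pos m0 mA.
have g0 : gauge A 0 = 0.
  by apply/eqP; rewrite eq_le gauge_ge0 andbT; have [B _ /(_ 0)] := gauge_le_norm A;
    rewrite normr0 mulr0.
rewrite (inner_domainE z0 m0 mA) (outer_domainE z0 m0 mA) => _ [_ [->|[z /= z1 <-]] <-].
  by exists z0 => //=; rewrite subrr g0.
have zz0 : z != z0 by apply: contraTneq z1 => ->; rewrite subrr g0 ltNge ler01.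
exists (star_refl A z0 z); last by rewrite sphere_refl_Some.
by rewrite /= gauge_star_refl// invf_lt1// (lt_trans _ z1).
Qed.

(** With [tau = sinh s] one has [K = e^(2 s)] and the ratio is [tanh s]. Algebraically,
    [q^2 - tau^2 = 1] gives [K - 1 = 2 tau (q + tau)] and [K + 1 = 2 q (q + tau)]. *)
Lemma dilatation_ratio (tau : R) (K := (Num.sqrt (1 + tau ^+ 2) + tau) ^+ 2) :
  0 <= tau -> 1 <= K /\ (K - 1) / (K + 1) = tau / Num.sqrt (1 + tau ^+ 2).
Proof.
move=> tau0; rewrite {}/K; set q := Num.sqrt _.
have q2 : q ^+ 2 = 1 + tau ^+ 2 by rewrite sqr_sqrtr// addr_ge0// sqr_ge0.
have q1 : 1 <= q by rewrite -sqrtr1 ler_wsqrtr// lerDl sqr_ge0.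
have q0 : 0 < q by rewrite (lt_le_trans _ q1).
split; first by rewrite exprn_ege1// (le_trans q1)// lerDl.
have -> : (q + tau) ^+ 2 - 1 = 2 * tau * (q + tau) by rewrite sqrrD q2; ring.
have -> : (q + tau) ^+ 2 + 1 = 2 * q * (q + tau).
  by rewrite [X in _ + X](_ : 1 = q ^+ 2 - tau ^+ 2); [ring|rewrite q2; ring].
have qt : q + tau != 0 by rewrite gt_eqF// ltr_wpDr.
by field; rewrite qt gt_eqF.
Qed.

(** The cone condition concerns each normal only in the sector where it attains the gauge. The bound
    [m] says that the polygon is bounded. *)
Theorem star_quasiconformal_reflection A z0 m tau :
  0 < m -> (forall v, m * `|v| <= gauge A v) -> 0 <= tau ->
  (forall a v, a \in A -> dot a v = gauge A v ->
     `|v.1 * a.2 - v.2 * a.1| <= tau * dot a v) ->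
  quasiconformal_reflection ((Num.sqrt (1 + tau ^+ 2) + tau) ^+ 2)
    (gauge_circle A z0) (sphere_refl A z0).
Proof.
move=> m0 mA tau0 cone; have Apos := gauge_lb_pos m0 mA.
have [_ kE] := dilatation_ratio tau0.
have rK := sphere_reflK z0 Apos.
have rI := sphere_refl_inner (z0 := z0) m0 mA.
have rO := sphere_refl_outer (z0 := z0) m0 mA.
split.
- split; first exact: sphere_refl_homeomorphism mA.
  exact/star_refl_analytic_qc/(qc_off_star_refl z0 Apos tau0 kE cone).
- move=> z z1; have zz0 : z != z0.
    apply/eqP => e; move: z1; rewrite /gauge_circle/= e subrr.
    have [B _ /(_ 0)] := gauge_le_norm A; rewrite normr0 mulr0 => /[swap] ->.
    by rewrite ler10.
  rewrite sphere_refl_Some// /star_refl /gauge_inv z1 expr1n invr1 scale1r.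
  by rewrite addrC subrK.
(* An involution that maps each domain into the other maps it onto the other. *)
- apply/seteqP; split=> // s Os; exists (sphere_refl A z0 s) => //.
  by apply: rO; exists s.
- apply/seteqP; split=> // s Os; exists (sphere_refl A z0 s) => //.
  by apply: rI; exists s.
Qed.

End StarDomain.

(** * The trapezoid as a gauge circle and its cone bounds *)

Section TrapezoidGauge.
Variable R : realType.
Implicit Types (A : seq (R * R)) (a v z : R * R) (c d k e u : R).

Lemma gauge_eq1 A v : gauge A v = 1 <->
  (forall a, a \in A -> dot a v <= 1) /\ (exists2 a, a \in A & dot a v = 1).
Proof.
split=> [g1|[le1 [a aA a1]]].
  split=> [a /le_gauge le|]; first by rewrite -g1.
  by have [|a aA a1] := @gauge_attained _ A v; [rewrite g1|exists a; rewrite ?a1].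
by rewrite -a1; apply: gauge_eq_dot => //; rewrite a1 // => b /le1.
Qed.

(** Translates a normalised functional seen from the centre into the equation and half-plane of its
    side in the original coordinates. *)
Lemma le1_shift k e u : 0 < k -> u - 1 = k * e ->
  (u <= 1 <-> e <= 0) /\ (u = 1 <-> e = 0).
Proof.
move=> k0 ue; split; first by rewrite -subr_le0 ue pmulr_rle0.
split=> h; first by apply: (mulfI (lt0r_neq0 k0)); rewrite -ue h subrr mulr0.
by apply/eqP; rewrite -subr_eq0 ue h mulr0.
Qed.

(* The point from which both parallel sides are seen at the same angle: the
   cotangent of the angle between radius and side is c + d at their endpoints. *)
Definition trapezoid_center c d : R * R := (0, - (c / (c + d))).

(** The reciprocal of [2 c d / (c + d)], the constant value of [v.1 + (d - c) v.2] along the right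
    side. *)
Definition side_scale c d : R := (c + d) / (2 * c * d).

(* Scaled so that each side lies on dot a v = 1, v being measured from the centre *)
Definition top_normal c d : R * R := (0, (c + d) / c).
Definition bottom_normal c d : R * R := (0, - ((c + d) / d)).
Definition right_normal c d : R * R := (side_scale c d, (d - c) * side_scale c d).
Definition left_normal c d : R * R := (- side_scale c d, (d - c) * side_scale c d).

Definition trapezoid_normals c d : seq (R * R) :=
  [:: top_normal c d; bottom_normal c d; right_normal c d; left_normal c d].

Lemma forall_trapezoid_normals c d (P : R * R -> Prop) :
  (forall a, a \in trapezoid_normals c d -> P a) <->
  [/\ P (top_normal c d), P (bottom_normal c d), P (right_normal c d) &
      P (left_normal c d)].
Proof.
split=> [h|[h1 h2 h3 h4] a]; first by split; apply: h; rewrite !inE eqxx ?orbT.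
by rewrite !inE => /or4P[] /eqP ->.
Qed.

Section Trapezoid.
Variables (c d : R).
Hypotheses (hc : 0 < c) (hcd : c <= d).

Let d0 : 0 < d. Proof. exact: lt_le_trans hcd. Qed.
Let s0 : 0 < c + d. Proof. by rewrite addr_gt0. Qed.
Let k0 : 0 < side_scale c d. Proof. by rewrite divr_gt0// !mulr_gt0. Qed.
Let cn0 : c != 0. Proof. by rewrite gt_eqF. Qed.
Let dn0 : d != 0. Proof. by rewrite gt_eqF. Qed.
Let sn0 : c + d != 0. Proof. by rewrite gt_eqF. Qed.
Let z0 := trapezoid_center c d.

Lemma top_normal1 z : (dot (top_normal c d) (z - z0) <= 1 <-> z.2 <= 0) /\
  (dot (top_normal c d) (z - z0) = 1 <-> z.2 = 0).
Proof.
apply: (@le1_shift ((c + d) / c)); first by rewrite divr_gt0.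
by rewrite /dot /top_normal /z0 /trapezoid_center/=; field; rewrite cn0 sn0.
Qed.

Lemma bottom_normal1 z : (dot (bottom_normal c d) (z - z0) <= 1 <-> - (z.2 + 1) <= 0) /\
  (dot (bottom_normal c d) (z - z0) = 1 <-> - (z.2 + 1) = 0).
Proof.
apply: (@le1_shift ((c + d) / d)); first by rewrite divr_gt0.
by rewrite /dot /bottom_normal /z0 /trapezoid_center/=; field; rewrite dn0 sn0.
Qed.

Lemma right_normal1 z :
  (dot (right_normal c d) (z - z0) <= 1 <-> z.1 + (d - c) * z.2 - c <= 0) /\
  (dot (right_normal c d) (z - z0) = 1 <-> z.1 + (d - c) * z.2 - c = 0).
Proof.
apply: (le1_shift k0).
rewrite /dot /right_normal /z0 /trapezoid_center/= /side_scale.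
by field; rewrite cn0 dn0 sn0.
Qed.

Lemma left_normal1 z :
  (dot (left_normal c d) (z - z0) <= 1 <-> - z.1 + (d - c) * z.2 - c <= 0) /\
  (dot (left_normal c d) (z - z0) = 1 <-> - z.1 + (d - c) * z.2 - c = 0).
Proof.
apply: (le1_shift k0).
rewrite /dot /left_normal /z0 /trapezoid_center/= /side_scale.
by field; rewrite cn0 dn0 sn0.
Qed.

(** The boundary of an intersection of half-planes: all four constraints hold and one is tight. On
    the tight side the segment parameter is solved from a coordinate. *)
Lemma trapezoidE : trapezoid c d = gauge_circle (trapezoid_normals c d) z0.
Proof.
apply/seteqP; split=> z.
  have bounds : [/\ z.2 <= 0, - (z.2 + 1) <= 0, z.1 + (d - c) * z.2 - c <= 0 &
      - z.1 + (d - c) * z.2 - c <= 0] ->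
      (exists2 a, a \in trapezoid_normals c d & dot a (z - z0) = 1) ->
      gauge_circle (trapezoid_normals c d) z0 z.
    move=> [b1 b2 b3 b4] ex; apply/gauge_eq1; split=> //.
    apply/forall_trapezoid_normals; split.
    - exact/(top_normal1 z).1.
    - exact/(bottom_normal1 z).1.
    - exact/(right_normal1 z).1.
    - exact/(left_normal1 z).1.
  (* The products of [t] and [1 - t] with [c] and [d] are supplied so that [lra] can treat them as
     atoms. *)
  move=> [[[|]|]|] [t]; rewrite /= in_itv/= => /andP[t0 t1] zE;
    have u0 : 0 <= 1 - t by [rewrite subr_ge0]; have p1 := mulr_ge0 t0 (ltW hc);
    have p2 := mulr_ge0 t0 (ltW d0); have p3 := mulr_ge0 u0 (ltW hc);
    have p4 := mulr_ge0 u0 (ltW d0); apply: bounds; rewrite -?zE /=.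
  - by split; lra.
  - exists (left_normal c d); first by rewrite !inE eqxx !orbT.
    by apply/(left_normal1 _).2; rewrite /=; ring.
  - by split; lra.
  - exists (top_normal c d); first by rewrite !inE eqxx.
    by apply/(top_normal1 _).2; rewrite /=; ring.
  - by split; lra.
  - exists (right_normal c d); first by rewrite !inE eqxx !orbT.
    by apply/(right_normal1 _).2; rewrite /=; ring.
  - by split; lra.
  - exists (bottom_normal c d); first by rewrite !inE eqxx !orbT.
    by apply/(bottom_normal1 _).2; rewrite /=; ring.
move=> /gauge_eq1[/forall_trapezoid_normals[]].
move=> /(top_normal1 z).1 b1 /(bottom_normal1 z).1 b2
  /(right_normal1 z).1 b3 /(left_normal1 z).1 b4.
case: z b1 b2 b3 b4 => x y /= b1 b2 b3 b4 [a]; rewrite !inE => /or4P[] /eqP ->.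
- move=> /(top_normal1 (x, y)).2/= y0; left; left; right.
  rewrite {}y0 !mulr0 !addr0 in b3 b4 *.
  have c20 : 0 < 2 * c by rewrite mulr_gt0.
  exists ((x + c) / (2 * c)); last by congr pair => /=; field.
  by rewrite /= in_itv/= ler_pdivlMr// ler_pdivrMr//; apply/andP; split; lra.
- move=> /(bottom_normal1 (x, y)).2/= y1; right.
  have {}y1 : y = -1 by lra.
  rewrite {}y1 in b3 b4 *.
  have d20 : 0 < 2 * d by rewrite mulr_gt0.
  exists ((d - x) / (2 * d)); last by congr pair => /=; field.
  by rewrite /= in_itv/= ler_pdivlMr// ler_pdivrMr//; apply/andP; split; lra.
- move=> /(right_normal1 (x, y)).2/= xE; left; right.
  exists (- y); first by rewrite /= in_itv/=; lra.
  by congr pair => /=; [lra|ring].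
- move=> /(left_normal1 (x, y)).2/= xE; left; left; left.
  exists (y + 1); first by rewrite /= in_itv/=; lra.
  by congr pair => /=; [lra|ring].
Qed.

(** Serves twice: with [g] the gauge for its lower bound, and with [g = dot a v] in the sector of
    [a]. *)
Lemma dot_trapezoid_le v g : (forall a, a \in trapezoid_normals c d -> dot a v <= g) ->
  [/\ (c + d) * v.2 <= c * g, - ((c + d) * v.2) <= d * g,
      (c + d) * (v.1 + (d - c) * v.2) <= 2 * c * d * g &
      (c + d) * (- v.1 + (d - c) * v.2) <= 2 * c * d * g].
Proof.
move=> /forall_trapezoid_normals[].
rewrite /dot/top_normal /bottom_normal /right_normal /left_normal /side_scale/=.
move=> h1 h2 h3 h4.
have scale (k u u' : R) : 0 < k -> u' = k * u -> u <= g -> u' <= k * g.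
  by move=> kp -> ug; rewrite ler_pM2l.
split.
- by apply: scale h1 => //; field.
- by apply: scale h2 => //; field.
- by apply: scale h3; [rewrite !mulr_gt0|field; rewrite cn0 dn0].
- by apply: scale h4; [rewrite !mulr_gt0|field; rewrite cn0 dn0].
Qed.

Lemma trapezoid_gauge_lb : exists2 m, 0 < m &
  forall v, m * `|v| <= gauge (trapezoid_normals c d) v.
Proof.
(* [|v.2| <= g] and [|v.1| <= 2 c d / (c + d) g + (d - c) |v.2|]; the sum of the two constants
   serves both coordinates. *)
pose M := 1 + 2 * c * d / (c + d) + (d - c).
have M0 : 0 < M.
  rewrite /M; have : 0 <= 2 * c * d / (c + d) by rewrite divr_ge0// ?mulr_ge0// ltW.
  by move: hcd; lra.
exists M^-1; first by rewrite invr_gt0.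
move=> v; set g := gauge _ _; rewrite ler_pdivrMl//.
have [h1 h2 h3 h4] := @dot_trapezoid_le v g (fun a => @le_gauge _ _ a v).
have g0 : 0 <= g by exact: gauge_ge0.
have cg := mulr_ge0 (ltW hc) g0; have dg := mulr_ge0 (ltW d0) g0.
have q1 : v.2 <= g by rewrite -(ler_pM2l s0); lra.
have q2 : - v.2 <= g by rewrite -(ler_pM2l s0); lra.
have dc0 : 0 <= d - c by rewrite subr_ge0.
have A1 : 0 <= (c + d) * ((d - c) * (g + v.2)).
  by rewrite mulr_ge0 ?(ltW s0)// mulr_ge0//; lra.
have A2 : 0 <= (c + d) * ((d - c) * (g - v.2)).
  by rewrite mulr_ge0 ?(ltW s0)// mulr_ge0//; lra.
have A3 : 0 <= (c + d) * (g - v.2) by rewrite mulr_ge0 ?(ltW s0)//; lra.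
have A4 : 0 <= (c + d) * (g + v.2) by rewrite mulr_ge0 ?(ltW s0)//; lra.
have A5 : 0 <= c * (d * g) by rewrite mulr_ge0// ltW.
have E : (c + d) * M = (c + d) * (1 + (d - c)) + 2 * c * d by rewrite /M; field.
rewrite prod_normE ge_max !ler_norml; apply/andP; split; apply/andP; split;
  rewrite -(ler_pM2l s0) ?mulrN ?mulrA E; lra.
Qed.

(** For fixed [w = p + (d - c) q] the left side is affine in [q] inside the modulus, so the ends of
    the range of [q] decide. The lower corner [q = - w / (2 c)] gives the constant exactly. *)
Lemma trapezoid_side_cone (p q tau : R) : (1 - c ^+ 2 + d ^+ 2) / (2 * c) <= tau ->
  2 * d * q <= p + (d - c) * q -> - (2 * c * q) <= p + (d - c) * q ->
  `|p * (d - c) - q| <= tau * (p + (d - c) * q).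
Proof.
move=> tauT; set w := p + _ => h1 h2.
have w0 : 0 <= w.
  have [q0|q0] := leP 0 q; first by have := mulr_ge0 (ltW d0) q0; lra.
  by have : 0 <= c * - q by [rewrite mulr_ge0 ?oppr_ge0// ltW]; lra.
have -> : p * (d - c) - q = (d - c) * w - ((d - c) ^+ 2 + 1) * q by rewrite /w; ring.
apply: (@le_trans _ _ ((1 - c ^+ 2 + d ^+ 2) / (2 * c) * w)); last by rewrite ler_wpM2r.
have c20 : 0 < 2 * c by rewrite mulr_gt0.
have P0 : 0 <= (d - c) ^+ 2 + 1 by rewrite addr_ge0// sqr_ge0.
rewrite mulrAC ler_norml lerNl ler_pdivlMr// ler_pdivlMr//; apply/andP; split.
  have hq : ((d - c) ^+ 2 + 1) * (2 * d * q) <= ((d - c) ^+ 2 + 1) * w.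
    by rewrite ler_wpM2l.
  rewrite -(ler_pM2l d0).
  (* At the upper corner [q = w / (2 d)] the remaining slack is [(d - c) ((c + d)^2 + 1) w], the sum
     of the next two terms. *)
  have cd0 : 0 <= (d - c) * w by rewrite mulr_ge0// subr_ge0.
  have dcw : 0 <= (d - c) * (c + d) ^+ 2 * w.
    by rewrite mulr_ge0// mulr_ge0 ?sqr_ge0// subr_ge0.
  have : c * (((d - c) ^+ 2 + 1) * (2 * d * q)) <= c * (((d - c) ^+ 2 + 1) * w).
    by rewrite ler_pM2l.
  by lra.
have hq : ((d - c) ^+ 2 + 1) * (- (2 * c * q)) <= ((d - c) ^+ 2 + 1) * w.
  by rewrite ler_wpM2l.
by lra.
Qed.

(** In each sector the inequalities against the two neighbouring sides confine [v]. The left sector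
    is the mirror image of the right one, with [- p] for [p]. *)
Lemma trapezoid_cone tau a v : c + d <= tau ->
  (1 - c ^+ 2 + d ^+ 2) / (2 * c) <= tau ->
  a \in trapezoid_normals c d -> dot a v = gauge (trapezoid_normals c d) v ->
  `|v.1 * a.2 - v.2 * a.1| <= tau * dot a v.
Proof.
move=> tau1 tau2 aA av.
have [] := @dot_trapezoid_le v (dot a v) _.
  by move=> b bA; rewrite av le_gauge.
move: aA {av}; rewrite !inE; case: v => p q /= + h1 h2 h3 h4.
have flat (k u : R) : 0 <= k -> `|p| <= (c + d) * u -> `|p * k| <= tau * (k * u).
  move=> k1 pu; have u0 : 0 <= u by rewrite -(pmulr_rge0 _ s0) (le_trans _ pu).
  rewrite normrM (ger0_norm k1) mulrCA mulrC ler_wpM2l// (le_trans pu)//.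
  by rewrite ler_wpM2r.
have kE : 2 * c * d * side_scale c d = c + d.
  by rewrite /side_scale; field; rewrite cn0 dn0.
move=> /or4P[] /eqP aE; rewrite {}aE /dot /= in h1 h2 h3 h4 *.
- rewrite mul0r add0r mulr0 subr0 in h1 h2 h3 h4 *; apply: flat.
    by rewrite divr_ge0// ltW.
  have e : 2 * c * d * ((c + d) / c * q) = (c + d) * (2 * d * q) by field.
  rewrite {}e !(ler_pM2l s0) in h3 h4; rewrite ler_norml; apply/andP; split; lra.
- rewrite mul0r add0r mulr0 subr0 in h1 h2 h3 h4 *.
  have -> : p * - ((c + d) / d) = - (p * ((c + d) / d)) by ring.
  have -> : - ((c + d) / d) * q = (c + d) / d * - q by ring.
  rewrite normrN; apply: flat.
    by rewrite divr_ge0// ltW.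
  have e : 2 * c * d * (- ((c + d) / d) * q) = (c + d) * (- (2 * c * q)) by field.
  rewrite {}e !(ler_pM2l s0) in h3 h4; rewrite ler_norml; apply/andP; split; lra.
- have -> : p * ((d - c) * side_scale c d) - q * side_scale c d =
    (p * (d - c) - q) * side_scale c d by ring.
  have -> : tau * (side_scale c d * p + (d - c) * side_scale c d * q) =
    tau * (p + (d - c) * q) * side_scale c d by ring.
  rewrite normrM (gtr0_norm k0) ler_pM2r//.
  have e : (c + d) * (p + (d - c) * q) =
    2 * (c * d * (side_scale c d * p + (d - c) * side_scale c d * q)).
    by rewrite -[in LHS]kE; ring.
  apply: trapezoid_side_cone => //; rewrite -(ler_pM2l s0) e.
    by have := ler_wpM2l (ltW d0) h1; lra.
  by have := ler_wpM2l (ltW hc) h2; lra.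
- have -> : p * ((d - c) * side_scale c d) - q * - side_scale c d =
    - ((- p * (d - c) - q) * side_scale c d) by ring.
  have -> : tau * (- side_scale c d * p + (d - c) * side_scale c d * q) =
    tau * (- p + (d - c) * q) * side_scale c d by ring.
  rewrite normrN normrM (gtr0_norm k0) ler_pM2r//.
  have e : (c + d) * (- p + (d - c) * q) =
    2 * (c * d * (- side_scale c d * p + (d - c) * side_scale c d * q)).
    by rewrite -[in LHS]kE; ring.
  apply: trapezoid_side_cone => //; rewrite -(ler_pM2l s0) e.
    by have := ler_wpM2l (ltW d0) h1; lra.
  by have := ler_wpM2l (ltW hc) h2; lra.
Qed.

End Trapezoid.
End TrapezoidGauge.

Theorem theorem7p6 (R : realType) (c d : R) (hc : 0 < c) (hcd : c <= d) :
  let tau : R := Num.max (c + d) ((1 - c ^+ 2 + d ^+ 2) / (2 * c)) in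
  (QR (trapezoid c d) <= ((Num.sqrt (1 + tau ^+ 2) + tau) ^+ 2)%:E)%E.
Proof.
cbv zeta; set tau := Num.max _ _; apply: ereal_inf_lbound.
have tau1 : c + d <= tau by rewrite le_max lexx.
have tau2 : (1 - c ^+ 2 + d ^+ 2) / (2 * c) <= tau by rewrite le_max lexx orbT.
have tau0 : 0 <= tau by rewrite (le_trans _ tau1)// addr_ge0// ltW// (lt_le_trans hc).
have [m m0 mA] := trapezoid_gauge_lb hc hcd.
eexists; last by [].
split; first exact: (dilatation_ratio tau0).1.
exists (sphere_refl (trapezoid_normals c d) (trapezoid_center c d)).
rewrite trapezoidE//; apply: (star_quasiconformal_reflection _ m0 mA tau0) => a v.
exact: trapezoid_cone.
Qed.
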